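(* Let $m\ge 1$ be an integer and let $s$ be a real number with $0<s<m+1$. For the cone $SMET^{m,s}_{m+2}$ the following hold. (i) It has only one orbit of extreme rays. Each extreme ray contains a vector with $\lfloor s\rfloor+1$ components equal to $1$, one component equal to $s-\lfloor s\rfloor$, and all other components equal to $0$; every such vector lies on an extreme ray, and distinct such vectors lie on different extreme rays. (ii.1) If $s$ is an integer, the skeleton graph is the Johnson graph $J(m+2,s+1)$. (ii.2) If $s$ is not an integer, then two distinct extreme rays are adjacent if and only if the associated vectors (as in (i)) either have the same support, or differ only by the position of the value $s-\lfloor s\rfloor$. (iii.1) If $m\le s<m+1$, then both the skeleton graph and the ridge graph are $K_{m+2}$. (iii.2) If $1<s<m-1$, then the ridge graph is $K_{(m+2)\times 2}$. (iii.3) If $s=1<m-1$ or $1<s=m-1$, then the ridge graph is $K_{(m+2)\times 2}-K_{m+2}$. (iii.4) If $s=1=m-1$, then the ridge graph is $K_{(2+2)\times 2}-2K_{2+2}$, i.e. the graph of the $3$-cube.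
   Context: Let $V_n=\{1,\dots,n\}$ and let $\binom{V_n}{m+1}$ be the set of $(m+1)$-subsets of $V_n$. For $d\in\mathbb{R}^{\binom{V_n}{m+1}}$, an $(m+2)$-subset $T\subset V_n$ and $i\in T$, the $(m,s)$-simplex inequality is $$s\, d(T\setminus\{i\})\le \sum_{k\in T\setminus\{i\}} d(T\setminus\{k\}),$$ and for an $(m+1)$-subset $A\subset V_n$ the non-negativity inequality is $d(A)\ge 0$. The cone $SMET^{m,s}_n\subset\mathbb{R}^{\binom{V_n}{m+1}}$ of $(m,s)$-super-metrics is the set of all $d$ satisfying all $(m,s)$-simplex inequalities and all non-negativity inequalities on $V_n$. Here $n=m+2$, so vectors have $m+2$ components. For a polyhedral cone $C$: an extreme ray is a face of dimension $1$; a facet is a face of dimension $\dim(C)-1$; two extreme rays are adjacent if they generate a two-dimensional face; two facets are adjacent if their intersection has dimension $\dim(C)-2$. The skeleton graph has the extreme rays as nodes and the pairs of adjacent extreme rays as edges; the ridge graph has the facets as nodes and the pairs of adjacent facets as edges. A symmetry of $C\subset\mathbb{R}^N$ is a linear isometry $f$ of $\mathbb{R}^N$ with $f(C)=C$; the orbit of a face is the set of its images under the group of all symmetries of $C$. The support of a vector is the set of positions of its non-zero components. Graph notation (equalities of graphs are up to isomorphism): $J(N,k)$ has the $k$-subsets of an $N$-set as vertices, two being adjacent when they share $k-1$ elements; $K_N$ is the complete graph on $N$ vertices; $K_{N\times 2}$ is the complete $N$-partite graph with all parts of size $2$; $K_{N\times 2}-K_N$ is $K_{N\times 2}$ with the edges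 of one complete subgraph $K_N$ (containing one vertex from each part) removed; $K_{N\times 2}-2K_N$ is $K_{N\times 2}$ with the edges of two vertex-disjoint complete subgraphs $K_N$ removed. *)

(* Defs.v *)
From HB Require Import structures.
From mathcomp Require Import all_boot all_order all_algebra.
From mathcomp Require Import all_classical all_reals.
Set Implicit Arguments.
Unset Strict Implicit.
Unset Printing Implicit Defensive.
Import Order.TTheory GRing.Theory Num.Theory.
Local Open Scope classical_set_scope.
Local Open Scope ring_scope.

(* R^N with its coordinates indexed by a finite type; R^o (rather than R) gives
   access to the vectType structure, hence to subspaces and \dim. *)
Definition vec (R : realType) (I : finType) := {ffun I -> R^o}.

Definition dotp (R : realType) (I : finType) (a x : vec R I) : R :=
  \sum_i (a i : R) * (x i : R).

Definition enorm (R : realType) (I : finType) (x : vec R I) : R :=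
  Num.sqrt (dotp x x).

Section Cones.
Variables (R : realType) (I : finType).
Local Notation E := (vec R I).
Implicit Types (C F G S : set E).

Lemma span_dim_subproof S :
  exists d, `[< exists2 U : {vspace E}, S `<=` [set` U] & \dim U = d >].
Proof.
exists (\dim (fullv : {vspace E})); apply/asboolP; exists fullv => // x _ /=.
by rewrite memvf.
Qed.

(* The dimension of the linear span of S, i.e. the least dimension of a subspace
   containing S.  Cones and their faces contain 0, so for them the affine span
   is the linear span. *)
Definition span_dim S : nat := ex_minn (span_dim_subproof S).

Definition conic_hull S : set E :=
  [set x | exists (n : nat) (a : 'I_n -> R) (p : 'I_n -> E),
    [/\ forall i, 0 <= a i, forall i, S (p i) & x = \sum_(i < n) a i *: p i]].

(* Faces are cut out by valid inequalities; C itself (a = 0) is a face. *)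
Definition is_face C F : Prop :=
  exists a : E, (forall x, C x -> 0 <= dotp a x) /\
                F = [set x | C x /\ dotp a x = 0].

Definition extreme_ray C F : Prop := is_face C F /\ span_dim F = 1%N.

Definition facet C F : Prop := is_face C F /\ (span_dim F).+1 = span_dim C.

Definition adjacent_rays C F G : Prop :=
  is_face C (conic_hull (F `|` G)) /\ span_dim (conic_hull (F `|` G)) = 2%N.

Definition adjacent_facets C F G : Prop :=
  (span_dim (F `&` G)).+2 = span_dim C.

Definition cone_symmetry C (f : {linear E -> E}) : Prop :=
  (forall x y, enorm (f x - f y) = enorm (x - y)) /\ f @` C = C.

Definition face_orbit C F : set (set E) :=
  [set G | exists f : {linear E -> E}, cone_symmetry C f /\ G = f @` F].

End Cones.

Record graph := Graph {
  vertex_type : Type;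
  vertices : set vertex_type;
  adj : vertex_type -> vertex_type -> Prop }.
Arguments vertices : clear implicits.
Arguments adj : clear implicits.

Definition graph_iso (G H : graph) : Prop :=
  exists f : vertex_type G -> vertex_type H,
    set_bij (vertices G) (vertices H) f /\
    forall x y, vertices G x -> vertices G y -> (adj G x y <-> adj H (f x) (f y)).

Definition skeleton_graph (R : realType) (I : finType) (C : set (vec R I)) :=
  Graph [set F | extreme_ray C F] (adjacent_rays C).

Definition ridge_graph (R : realType) (I : finType) (C : set (vec R I)) :=
  Graph [set F | facet C F] (adjacent_facets C).

Definition johnson_graph (N k : nat) :=
  Graph [set A : {set 'I_N} | #|A| = k]
        (fun A B => #|A :&: B|.+1 = k).

Definition complete_graph (N : nat) :=
  Graph [set: 'I_N] (fun x y => x <> y).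

(* K_{N x 2}: the parts are {(i, false), (i, true)} for i : 'I_N. *)
Definition cocktail_graph (N : nat) :=
  Graph [set: 'I_N * bool] (fun x y => x.1 <> y.1).

Definition remove_edges_within (G : graph) (W : set (vertex_type G)) :=
  Graph (vertices G) (fun x y => adj G x y /\ ~ (W x /\ W y)).

Definition cocktail_minus_K (N : nat) :=
  @remove_edges_within (cocktail_graph N) [set x | x.2 = true].

Definition cocktail_minus_2K (N : nat) :=
  @remove_edges_within (cocktail_minus_K N) [set x | x.2 = false].

Definition cube_graph (N : nat) :=
  Graph [set: {ffun 'I_N -> bool}]
        (fun x y => #|[set i : 'I_N | x i != y i]%SET| = 1%N).

(* Coordinate positions: the (m+1)-subsets of V_n, with V_n taken to be 'I_n. *)
Definition msimplex (m n : nat) : finType := {A : {set 'I_n} | #|A| == m.+1}.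

(* d(A) for a bare set A; the value 0 for #|A| <> m+1 is junk, and is not
   reached in SMET. *)
Definition value_at (R : realType) (m n : nat) (d : vec R (msimplex m n))
    (A : {set 'I_n}) : R :=
  if insub A is Some a then d (a : msimplex m n) else 0.

Definition SMET (R : realType) (m : nat) (s : R) (n : nat)
    : set (vec R (msimplex m n)) :=
  [set d |
    (forall (T : {set 'I_n}) (i : 'I_n), #|T| = m.+2 -> i \in T ->
       s * value_at d (T :\ i) <=
         \sum_(k in T :\ i) value_at d (T :\ k)) /\
    (forall A : msimplex m n, 0 <= (d A : R))].

Definition frac_part (R : realType) (s : R) : R := s - (Num.floor s)%:~R.

(* floor(s) + 1 components equal to 1, one more equal to s - floor(s) (possibly
   0), the others equal to 0. *)
Definition ray_vector (R : realType) (I : finType) (s : R) (v : vec R I) : Prop :=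
  exists (P : {set I}) (p : I),
    [/\ #|P|%:Z = Num.floor s + 1, p \notin P &
        forall i, v i = if i \in P then 1
                        else if i == p then frac_part s else 0].

Definition same_support (R : realType) (I : finType) (v w : vec R I) : Prop :=
  forall i, (v i != 0) = (w i != 0).

(* w is v with the value c moved from position i to position j, which was empty;
   the positions of all other non-zero values are unchanged. *)
Definition differ_by_position_of (R : realType) (I : finType) (c : R)
    (v w : vec R I) : Prop :=
  exists i j : I,
    [/\ v i = c, w j = c, v j = 0, w i = 0 &
        forall k, k != i -> k != j -> v k = w k].

(* Main.v *)
Require Import Defs.
From HB Require Import structures.
From mathcomp Require Import all_boot all_order all_algebra.
From mathcomp Require Import all_classical all_reals.
From mathcomp Require Import ring lra zify.
Import Order.TTheory GRing.Theory Num.Theory.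
Local Open Scope classical_set_scope.
Local Open Scope ring_scope.
Set Implicit Arguments.
Unset Strict Implicit.
Unset Printing Implicit Defensive.

(** Index the coordinates by the points [i] of V_(m+2), through
    [opposite_face], and put [t = s + 1].  Adding the value at [i] to both sides
    turns the simplex inequality at [i] into [t * x i <= \sum_k x k], so the
    cone is [{x | 0 <= x i and t * x i <= \sum_k x k for all i}]
    ([SMET_hyper_cone]): the cone over the hypersimplex of all [x] with
    coordinates in [0, 1] and sum [t], where [1 < t < m + 2].  It makes sense
    over any finite index type, and it is studied in that generality.

    Everything rests on one description of the faces.  A coordinate is slack at
    [x] if both of its inequalities are strict there.  Each face is the smallest
    face [min_face x] of one of its points, obtained by adding up enough points
    of the face ([face_eq_min_face]); and for [x != 0] the span of [min_face x]
    has dimension [max 1 d], where [d] is the number of slack coordinates at [x]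
    ([span_dim_ray], [span_dim_slack]).  What remains is to count slack
    coordinates.

    Extreme rays.  Each is generated by a unique point of sum [t] with at most
    one slack coordinate.  The other coordinates of that point are 0 or 1, so
    the sum forces [floor s + 1] ones and one entry [s - floor s]
    ([ray_vectorP]).  Two such vectors differ by a permutation of the
    coordinates, which is a symmetry; so there is one orbit.

    Skeleton.  Two rays with generators [v] and [w] are adjacent exactly when
    [v + w] has two slack coordinates ([adjacent_raysP]): the smallest face
    containing both is [min_face (v + w)], and once it is two-dimensional it
    equals the cone spanned by [v] and [w], because both are extreme.  A
    coordinate is not slack at [v + w] exactly when [v] and [w] are both 0 or
    both 1 there, so the adjacency conditions become a count of the coordinates
    in which two vectors differ.

    Ridges.  A facet has exactly one coordinate that is not slack, so it is
    [x i = 0] or [t * x i = \sum_k x k] ([facetP]).  Fixing [z] coordinates at 0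
    and [b] other ones at their maximum leaves a face of the expected dimension
    [m + 2 - z - b], if this is at least 2, exactly when [b < t < m + 2 - z]: the
    remaining coordinates, scaled to total sum [t], must be able to have sum
    [t - b] and lie strictly between 0 and 1 ([span_dim_cut],
    [span_dim_cut_inv]).  Applying this with
    [z + b = 1] tells which cuts are facets, and with [z + b = 2] which pairs of
    facets are adjacent. *)

(** * The cone over a hypersimplex and its faces *)

Section Cone.
Variables (R : realType) (I : finType).
Local Notation E := (vec R I).
Implicit Types (a u v w x y z : E) (t : R) (i k : I) (F G : set E).

Definition mass x : R := \sum_i (x i : R).

Lemma massD x y : mass (x + y) = mass x + mass y.
Proof. by rewrite /mass -big_split; apply: eq_bigr => i _; rewrite ffunE. Qed.

Lemma massZ (c : R) x : mass (c *: x) = c * mass x.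
Proof. by rewrite /mass mulr_sumr; apply: eq_bigr => i _; rewrite ffunE. Qed.

Lemma vecD x y i : (x + y) i = x i + y i :> R. Proof. by rewrite ffunE. Qed.
Lemma vecZ (c : R) x i : (c *: x) i = c * x i :> R. Proof. by rewrite ffunE. Qed.
Lemma vec0 i : (0 : E) i = 0 :> R. Proof. by rewrite ffunE. Qed.

Lemma mass0 : mass 0 = 0.
Proof. by rewrite -(scale0r (0 : E)) massZ mul0r. Qed.

Lemma dotpD a x y : dotp a (x + y) = dotp a x + dotp a y.
Proof.
by rewrite /dotp -big_split; apply: eq_bigr => i _; rewrite vecD mulrDr.
Qed.

Lemma dotpZ a (c : R) x : dotp a (c *: x) = c * dotp a x.
Proof.
by rewrite /dotp mulr_sumr; apply: eq_bigr => i _; rewrite vecZ mulrCA.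
Qed.

Lemma dotp0 a : dotp a 0 = 0.
Proof. by rewrite -(scale0r (0 : E)) dotpZ mul0r. Qed.

(** The inverse of the step only has to exceed every ratio [`|q j| / p j]. *)
Lemma small_step (J : finType) (p q : J -> R) :
  exists2 e : R, 0 < e & forall j, 0 < p j -> 0 < p j + e * q j.
Proof.
pose M := 1 + \sum_(j | 0 < p j) `|q j| / p j.
have M0 : 0 < M by rewrite ltr_wpDr // sumr_ge0 // => j pj; rewrite divr_ge0 // ltW.
exists M^-1; first by rewrite invr_gt0.
move=> j pj; rewrite -(pmulr_rgt0 _ M0) mulrDr mulrA divff ?gt_eqF // mul1r.
have : `|q j| / p j < M.
  rewrite /M (bigD1 j) //= addrCA ltrDl ltr_pwDl // sumr_ge0 // => i /andP[pi _].
  by rewrite divr_ge0 // ltW.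
rewrite ltr_pdivrMr // => H.
have := ler_norm (- q j); rewrite normrN; lra.
Qed.

(** The cone over the hypersimplex of the vectors with coordinates in [0, 1]
    and sum [t]. *)
Definition hyper_cone t : set E :=
  [set x : E | forall i, 0 <= (x i : R) /\ t * x i <= mass x].

(** The coordinates with no tight inequality at [x].  At a non-zero point of the
    cone the two inequalities of a coordinate cannot both be tight. *)
Definition slack t x : {set I} :=
  [set i | (0 < (x i : R)) && (t * x i < mass x)]%SET.

(** The smallest face that contains [x]: see [min_face_is_face] and
    [min_face_sub]. *)
Definition min_face t x : set E :=
  [set y : E | hyper_cone t y /\ forall i,
     (x i = 0 -> y i = 0) /\ (t * x i = mass x -> t * y i = mass y)].

Definition cut t (Z B : {set I}) : set E :=
  [set y : E | [/\ hyper_cone t y, forall i, i \in Z -> y i = 0 &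
                 forall i, i \in B -> t * y i = mass y]].

Section FixT.
Variable t : R.
Local Notation C := (hyper_cone t).
Local Notation slack := (slack t).
Local Notation min_face := (min_face t).

Lemma cone0 : C 0.
Proof. by move=> i; rewrite vec0 mass0 mulr0. Qed.

Lemma coneD x y : C x -> C y -> C (x + y).
Proof.
move=> Cx Cy i; have [? ?] := Cx i; have [? ?] := Cy i.
rewrite vecD massD mulrDr; lra.
Qed.

Lemma coneZ (c : R) x : 0 <= c -> C x -> C (c *: x).
Proof.
move=> c0 Cx i; have [x0 xt] := Cx i; rewrite vecZ massZ mulrCA.
by rewrite mulr_ge0 // ler_wpM2l.
Qed.

Lemma mass_ge0 x : C x -> 0 <= mass x.
Proof. by move=> Cx; apply: sumr_ge0 => i _; case: (Cx i). Qed.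

Lemma mass_eq0 x : C x -> mass x = 0 -> x = 0.
Proof.
move=> Cx /eqP; rewrite psumr_eq0; last by move=> i _; case: (Cx i).
by move=> /allP x0; apply/ffunP => i; rewrite vec0; apply/eqP/x0; rewrite mem_index_enum.
Qed.

Lemma mass_gt0 x : C x -> x <> 0 -> 0 < mass x.
Proof.
move=> Cx x0; rewrite lt_def mass_ge0 // andbT.
by apply/eqP => /(mass_eq0 Cx).
Qed.

Lemma min_face_refl x : C x -> min_face x x.
Proof. by []. Qed.

Lemma min_face_cone x y : min_face x y -> C y. Proof. by case. Qed.

Lemma min_faceD x y z : min_face x y -> min_face x z -> min_face x (y + z).
Proof.
move=> [Cy Hy] [Cz Hz]; split; first exact: coneD.
move=> i; rewrite vecD massD mulrDr; split=> H.
  by rewrite (Hy i).1 // (Hz i).1 // addr0.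
by rewrite (Hy i).2 // (Hz i).2.
Qed.

Lemma min_faceZ x y (c : R) : 0 <= c -> min_face x y -> min_face x (c *: y).
Proof.
move=> c0 [Cy Hy]; split; first exact: coneZ.
move=> i; rewrite vecZ massZ mulrCA; split=> H.
  by rewrite (Hy i).1 // mulr0.
by rewrite (Hy i).2.
Qed.

Lemma min_face0 x : min_face x 0.
Proof. by split; [exact: cone0|move=> i; rewrite vec0 mass0 mulr0]. Qed.

(** The sum of the chosen inequalities is a valid inequality, and it is tight
    only where each of them is. *)
Lemma cut_is_face (Z B : {set I}) : is_face C (cut t Z B).
Proof.
pose a : E := [ffun j => (j \in Z)%:R + (#|B|%:R - t * (j \in B)%:R)].
have aE y : dotp a y = \sum_(i in Z) y i + \sum_(i in B) (mass y - t * y i).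
  rewrite /dotp sumrB sumr_const -[mass y *+ _]mulr_natl -mulr_sumr /mass mulr_sumr.
  rewrite !(big_mkcond (fun i => i \in _)) /= mulr_sumr -sumrB -big_split /=.
  apply: eq_bigr => i _; rewrite ffunE.
  by case: (i \in Z); case: (i \in B); rewrite /= ?mulr1n; ring.
have pZ y : C y -> forall i, i \in Z -> 0 <= (y i : R) by move=> Cy i _; case: (Cy i).
have pB y : C y -> forall i, i \in B -> 0 <= mass y - t * y i.
  by move=> Cy i _; case: (Cy i); rewrite subr_ge0.
exists a; split=> [y Cy|].
  by rewrite aE addr_ge0 // sumr_ge0 //; [exact: pZ|exact: pB].
apply/seteqP; split=> y /=.
  move=> [Cy yZ yB]; split=> //; rewrite aE !big1 ?addr0 // => i.
  by move=> /yB ->; rewrite subrr.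
move=> [Cy /eqP]; rewrite aE paddr_eq0; [|by rewrite sumr_ge0 //; exact: pZ|
  by rewrite sumr_ge0 //; exact: pB].
rewrite !psumr_eq0; [|exact: pB|exact: pZ].
move=> /andP[/allP hZ /allP hB]; split=> // i ij.
  by have /implyP/(_ ij)/eqP := hZ i (mem_index_enum _).
by have /implyP/(_ ij)/eqP/subr0_eq := hB i (mem_index_enum _).
Qed.

Lemma min_face_is_face x : is_face C (min_face x).
Proof.
suff -> : min_face x = cut t [set i | x i == 0 :> R]%SET [set i | t * x i == mass x]%SET.
  exact: cut_is_face.
apply/seteqP; split=> y; last first.
  by move=> [Cy yZ yB]; split=> // i; split=> xi; [apply: yZ|apply: yB]; rewrite inE xi.
by move=> [Cy Hy]; split=> // i; rewrite inE => /eqP; case: (Hy i).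
Qed.

(** A direction that keeps the inequalities tight at [x] tight can be followed
    for a short while inside the cone, since the others are strict at [x]. *)
Lemma min_face_step x y :
  C x -> (forall i, (x i = 0 -> y i = 0) /\ (t * x i = mass x -> t * y i = mass y)) ->
  exists2 e : R, 0 < e & min_face x (x + e *: y).
Proof.
move=> Cx Hy.
pose p (ib : I * bool) : R := if ib.2 then x ib.1 else mass x - t * x ib.1.
pose q (ib : I * bool) : R := if ib.2 then y ib.1 else mass y - t * y ib.1.
have [e e0 He] := small_step p q; exists e => //.
have H i : (x i = 0 -> (x + e *: y) i = 0) /\
  (t * x i = mass x -> t * (x + e *: y) i = mass (x + e *: y)).
  rewrite vecD vecZ massD massZ; split=> h.
    by rewrite h (Hy i).1 // mulr0 addr0.
  by rewrite mulrDr mulrCA h (Hy i).2.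
split=> // i; have [x0 xt] := Cx i; split.
  have [/(H i).1 -> //|xi] := eqVneq (x i : R) 0.
  by rewrite vecD vecZ ltW //; apply: (He (i, true)); rewrite lt_def xi.
have [/(H i).2 -> //|xi] := eqVneq (t * x i) (mass x).
have := He (i, false); rewrite /p /q /= subr_gt0 lt_def eq_sym xi xt => /(_ isT).
rewrite vecD vecZ massD massZ; lra.
Qed.

Lemma face_subset_cone F : is_face C F -> F `<=` C.
Proof. by move=> [a [_ ->]] x []. Qed.

(** From [x] one can still move a little in direction [- y].  A functional that
    is non-negative on the cone and vanishes at [x] is thus non-positive at [y]. *)
Lemma min_face_sub F x : is_face C F -> F x -> min_face x `<=` F.
Proof.
move=> [a [ha ->]] [Cx ax] y [Cy Hy]; split=> //.
have [|e e0 [Cxy _]] := @min_face_step x (- y) Cx.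
  move=> i; rewrite -scaleN1r vecZ massZ mulrCA.
  by split=> [/(Hy i).1|/(Hy i).2] ->; rewrite ?mulr0.
have := ha _ Cxy; rewrite dotpD ax add0r dotpZ -scaleN1r dotpZ => h.
by apply/le_anti; rewrite ha // andbT; nra.
Qed.

(** For each inequality that is strict somewhere on the face, choose a point
    of the face where it is strict.  Only inequalities tight on the whole face
    are tight at the sum of these points. *)
Lemma face_eq_min_face F : is_face C F -> exists2 x, F x & F = min_face x.
Proof.
move=> fF; have [a [ha FE]] := fF.
have FD x y : F x -> F y -> F (x + y).
  rewrite FE => -[Cx ax] [Cy ay]; split; first exact: coneD.
  by rewrite dotpD ax ay addr0.
have F0 : F 0 by rewrite FE; split; [exact: cone0|exact: dotp0].
have FC := face_subset_cone fF.
have wit (P : E -> Prop) : exists2 y, F y & (exists2 z, F z & P z) -> P y.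
  by have [[z Fz Pz]|nP] := pselect (exists2 z, F z & P z); [exists z|exists 0].
(* where there is no such point, [f i] and [g i] are 0 *)
have [f Ff] := @choice I E _ (fun i =>
  let: ex_intro2 y Fy Hy := wit (fun z => z i <> 0) in ex_intro _ y (conj Fy Hy)).
have [g Fg] := @choice I E _ (fun i =>
  let: ex_intro2 y Fy Hy := wit (fun z => t * z i <> mass z) in ex_intro _ y (conj Fy Hy)).
pose x := \sum_i (f i + g i).
have Fx : F x by apply: (big_ind F) => [||i _] //; apply: FD; [case: (Ff i)|case: (Fg i)].
exists x => //; apply/seteqP; split; last exact: min_face_sub.
have dec i : exists2 r, C r & x = f i + g i + r.
  exists (\sum_(k | k != i) (f k + g k)); last by rewrite /x (bigD1 i).
  apply: (big_ind C) => [||k _]; [exact: cone0|exact: coneD|].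
  by apply/FC/FD; [case: (Ff k)|case: (Fg k)].
move=> y Fy; split; first exact: FC.
move=> i; have [r Cr ->] := dec i.
have [/FC Cf Hf] := Ff i; have [/FC Cg Hg] := Fg i.
have := Cf i; have := Cg i; have := Cr i.
rewrite !vecD !massD !mulrDr => -[? ?] [? ?] [? ?]; split=> h.
  by apply: contrapT => yi; apply: Hf; [exists y|lra].
by apply: contrapT => yi; apply: Hg; [exists y|lra].
Qed.

End FixT.
End Cone.

(** * Dimensions of faces *)

Section Dimension.
Variables (R : realType) (I : finType).
Local Notation E := (vec R I).
Implicit Types (a u v w x y z : E) (t : R) (i k : I) (F G : set E).

Lemma span_dimE (S : set E) (U : {vspace E}) :
  S `<=` [set` U] -> (forall W : {vspace E}, S `<=` [set` W] -> (U <= W)%VS) ->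
  span_dim S = \dim U.
Proof.
move=> SU minU; rewrite /span_dim; case: ex_minnP => d /asboolP[W SW <-] dmin.
apply/eqP; rewrite eqn_leq; apply/andP; split.
  by apply: dmin; apply/asboolP; exists U.
exact/dimvS/minU.
Qed.

Lemma span_dim_witness (S : set E) :
  exists2 U : {vspace E}, S `<=` [set` U] & \dim U = span_dim S.
Proof. by rewrite /span_dim; case: ex_minnP => d /asboolP[U SU <-] _; exists U. Qed.

Lemma span_dim_le (S T : set E) : S `<=` T -> (span_dim S <= span_dim T)%N.
Proof.
move=> ST; have [U TU <-] := span_dim_witness T; rewrite /span_dim.
case: ex_minnP => d _ dmin; apply: dmin; apply/asboolP; exists U => // x Sx.
exact/TU/ST.
Qed.

Lemma span_dim0 : span_dim [set (0 : E)] = 0%N.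
Proof.
rewrite (@span_dimE _ 0%VS) ?dimv0 //; last by move=> W _; exact: sub0v.
by move=> _ -> /=; exact: mem0v.
Qed.

Section FixT.
Variable t : R.
Hypothesis t_gt0 : 0 < t.
Local Notation C := (hyper_cone t).
Local Notation slack := (slack t).
Local Notation min_face := (min_face t).

Lemma slackE x i : C x -> (i \notin slack x) = (x i == 0 :> R) || (t * x i == mass x).
Proof.
move=> /(_ i)[x0 xt]; rewrite inE negb_and -!leNgt.
by rewrite [x i == 0]eq_le x0 andbT [_ == mass x]eq_le xt.
Qed.

Lemma span_dim_ray x : C x -> x <> 0 -> #|slack x| = 0%N ->
  span_dim (min_face x) = 1%N.
Proof.
move=> Cx x0 /finset.cards0_eq s0; have Tx := mass_gt0 Cx x0.
have -> : 1%N = \dim <[x]> by rewrite dim_vline; move/eqP: x0 => ->.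
apply: span_dimE => [y [Cy Hy]|W sub] /=; last first.
  by rewrite -memvE; apply: sub; exact: min_face_refl.
apply/vlineP; exists (mass y / mass x); apply/ffunP => i; rewrite vecZ.
have : i \notin slack x by rewrite s0 inE.
rewrite slackE // => /orP[] /eqP xi; first by rewrite xi mulr0 (Hy i).1.
have ty := (Hy i).2 xi.
have t0 : t != 0 by apply: contraTneq Tx => t0; rewrite -xi t0 mul0r ltxx.
by apply: (mulfI t0); rewrite ty mulrCA xi divfK ?gt_eqF.
Qed.

(** Let [D] be the set of slack coordinates and [B] that of the coordinates where
    [t * x i] reaches the sum.  A point of the face is determined by its
    coordinates in [D]: each coordinate in [B] is a [1 / t] share of the total,
    hence [1 / (t - #|B|)] times the sum over [D].  The resulting vectors [b i]
    form a basis, and each [b i] is a direction in which [x] can move. *)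
Lemma span_dim_slack x : C x -> (0 < #|slack x|)%N ->
  span_dim (min_face x) = #|slack x|.
Proof.
move=> Cx /card_gt0P[i0 i0D]; set D := slack x in i0D *.
have Tx : 0 < mass x.
  move: i0D; rewrite inE => /andP[xi _]; apply: (mass_gt0 Cx) => x0.
  by rewrite x0 vec0 ltxx in xi.
pose B := [set i | t * x i == mass x]%SET.
have DB i : i \in D -> i \in B = false.
  by rewrite !inE => /andP[_ /lt_eqF].
(* each coordinate in [B] is a [1 / t] share of the total *)
have sumD y : min_face x y -> t * \sum_(i in D) y i = (t - #|B|%:R) * mass y.
  move=> [Cy Hy]; rewrite mulrBl {1}/mass [\sum_i y i](bigID (mem D)) /= mulrDr.
  rewrite -[LHS]addr0 -addrA; congr (_ + _).
  apply/esym/eqP; rewrite subr_eq0 mulr_sumr mulr_natl -sumr_const; apply/eqP.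
  rewrite [LHS]big_mkcond [RHS]big_mkcond; apply: eq_bigr => i _ /=.
  case: ifPn => [|/negPn /DB -> //].
  rewrite slackE // => /orP[] /eqP xi; rewrite [i \in B]inE; last first.
    by rewrite xi eqxx (Hy i).2.
  by rewrite xi mulr0 (lt_eqF Tx) (Hy i).1 ?mulr0.
have SD : 0 < \sum_(i in D) (x i : R).
  rewrite (bigD1 i0) //=; apply: ltr_wpDr.
    by apply: sumr_ge0 => i _; case: (Cx i).
  by move: i0D; rewrite inE => /andP[].
have sx := sumD x (min_face_refl Cx).
have tB : 0 < t - #|B|%:R by rewrite -(pmulr_lgt0 _ Tx) -sx mulr_gt0.
pose b i : E := [ffun l => (l == i)%:R + (l \in B)%:R / (t - #|B|%:R)].
have bD i l : l \in D -> b i l = (l == i)%:R :> R.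
  by move=> lD; rewrite ffunE DB // mul0r addr0.
have massb i : mass (b i) = t / (t - #|B|%:R).
  rewrite /mass (eq_bigr (fun l => (l == i)%:R + (l \in B)%:R / (t - #|B|%:R))); last first.
    by move=> l _; rewrite ffunE.
  have sB : \sum_l (l \in B)%:R = #|B|%:R :> R.
    by rewrite -sum1_card natr_sum [RHS]big_mkcond; apply: eq_bigr => l _; case: ifP.
  rewrite big_split /= -mulr_suml sB (bigD1 i) //= eqxx [X in _ + X + _]big1 ?addr0 => [|l /negPf -> //].
  by rewrite mulr1n; field; rewrite gt_eqF.
have freeb : free (map_tuple b (enum_tuple D)).
  apply/freeP => c /ffunP c0 j; have := c0 (enum_val j).
  rewrite vec0 sum_ffunE (bigD1 j) //= big1 => [|l lj].
    by rewrite addr0 (nth_map i0) -?cardE // -enum_val_nth vecZ bD ?enum_valP // eqxx mulr1.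
  rewrite (nth_map i0) -?cardE // -enum_val_nth vecZ bD ?enum_valP //.
  by rewrite (inj_eq enum_val_inj) eq_sym (negPf lj) mulr0.
have -> : #|D| = \dim <<[seq b i | i <- enum D]>>%VS.
  by rewrite (eqP freeb) size_tuple.
apply: span_dimE => [y Fy|W sub] /=.
  have Hy := Fy.2.
  have -> : y = \sum_(i in D) (y i : R) *: b i.
    apply/ffunP => l; rewrite sum_ffunE.
    rewrite (eq_bigr (fun i => (l == i)%:R * y i + y i * ((l \in B)%:R / (t - #|B|%:R)))); last first.
      by move=> i _; rewrite !ffunE /= -[_ *: _]/(_ * _) mulrDr mulrC.
    rewrite big_split /= -mulr_suml.
    have [lD|lD] := boolP (l \in D).
      rewrite DB // mul0r mulr0 addr0 (bigD1 l) //= eqxx mul1r big1 ?addr0 // => i /andP[_].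
      by rewrite eq_sym => /negPf ->; rewrite mul0r.
    rewrite big1 ?add0r; last first.
      move=> i iD; case: eqP => [li|]; last by rewrite mul0r.
      by rewrite li iD in lD.
    have [lB|lB] := boolP (l \in B).
      move: lB; rewrite inE => /eqP /(Hy l).2 yl.
      apply: (mulfI (lt0r_neq0 t_gt0)); rewrite mul1r mulrA sumD // yl.
      by field; rewrite gt_eqF.
    move: lD; rewrite slackE // => /orP[/eqP /(Hy l).1 ->|h]; first by rewrite mul0r mulr0.
    by rewrite inE h in lB.
  apply: memv_suml => i iD; apply/memvZ/memv_span/map_f.
  by rewrite mem_enum.
apply/span_subvP => z /mapP[i]; rewrite mem_enum => iD ->{z}.
have [|e e0 step] := @min_face_step _ _ t x (b i) Cx.
  move=> l; split=> h.
    rewrite ffunE; case: eqP => [li|_].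
      by move: iD; rewrite -li inE h ltxx.
    by rewrite inE h mulr0 lt_eqF // mul0r addr0.
  rewrite massb ffunE; case: eqP => [li|_].
    by move: iD; rewrite -li inE h ltxx andbF.
  by rewrite inE h eqxx add0r mul1r.
have xW := sub _ (min_face_refl Cx); have sW := sub _ step.
have -> : b i = e^-1 *: ((x + e *: b i) - x).
  by rewrite addrC addKr scalerA mulVf ?scale1r // gt_eqF.
by rewrite memvZ // memvB.
Qed.
End FixT.
End Dimension.

(** * Extreme rays and their adjacency *)

Section Rays.
Variables (R : realType) (I : finType) (t : R).
Hypotheses (t_gt0 : 0 < t) (t_lt : t < #|I|%:R).
Local Notation E := (vec R I).
Implicit Types (a u v w x y z : E) (i k : I) (F G : set E).
Local Notation C := (hyper_cone t).
Local Notation slack := (slack t).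
Local Notation min_face := (min_face t).

Lemma span_dim_min_face x : C x -> x <> 0 ->
  span_dim (min_face x) = maxn 1 #|slack x|.
Proof.
move=> Cx x0; case s0: #|slack x| => [|n]; first by rewrite span_dim_ray.
by rewrite (span_dim_slack t_gt0) // s0 // (maxn_idPr _).
Qed.

Lemma min_face_at0 : min_face (0 : E) = [set 0].
Proof.
apply/seteqP; split=> y /= => [[_ Hy]|->]; last exact: min_face0.
by apply/ffunP => i; rewrite (Hy i).1 ?vec0.
Qed.

Lemma span_dim_face F x : C x -> F = min_face x ->
  span_dim F = if x == 0 then 0%N else maxn 1 #|slack x|.
Proof.
move=> Cx ->; case: eqP => [->|x0]; last exact: span_dim_min_face.
by rewrite min_face_at0 span_dim0.
Qed.

Lemma span_dim_cone : span_dim (C : set E) = #|I|.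
Proof.
have I0 : (0 < #|I|)%N by rewrite -(ltr_nat R) (lt_trans t_gt0).
pose x : E := [ffun=> 1].
have mx : mass x = #|I|%:R.
  by rewrite /mass (eq_bigr (fun=> 1)) ?sumr_const // => i _; rewrite ffunE.
have sx : slack x = [set: I]%SET.
  by apply/setP => i; rewrite !inE mx ffunE mulr1 ltr01.
have Cx : C x by move=> i; rewrite mx ffunE mulr1 ler01 ltW.
have <- : min_face x = C.
  apply/seteqP; split=> y; first by case.
  move=> Cy; split=> // i; rewrite mx ffunE mulr1; split=> [/eqP|/eqP].
    by rewrite oner_eq0.
  by rewrite lt_eqF.
by rewrite (span_dim_slack t_gt0) // sx cardsT.
Qed.

(** A functional that is non-negative at two points and vanishes at their sum
    vanishes at both. *)
Lemma face_summand F x y : is_face C F -> C x -> C y -> F (x + y) -> F x.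
Proof.
move=> [a [ha ->]] Cx Cy [_]; rewrite dotpD => axy; split=> //.
by have := ha _ Cx; have := ha _ Cy; lra.
Qed.

Lemma extreme_ray_line F v y : extreme_ray C F -> F v -> v <> 0 -> F y ->
  y = (mass y / mass v) *: v.
Proof.
move=> [fF dF] Fv v0 Fy; have [U FU dU] := span_dim_witness F.
have mv : mass v != 0.
  by rewrite gt_eqF // (mass_gt0 (face_subset_cone fF Fv)).
have : (<[v]> == U)%VS.
  rewrite eqEdim -memvE dU dF dim_vline; apply/andP; split; first exact: FU.
  by move/eqP: v0 => ->.
move=> /eqP vU; have : y \in <[v]>%VS by rewrite vU; exact: FU.
by move=> /vlineP[k ->]; rewrite massZ mulfK.
Qed.

(** The points of the slice [mass x = t] that generate an extreme ray; they are
    the vertices of the hypersimplex. *)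
Definition unit_ray v := [/\ C v, mass v = t & (#|slack v| <= 1)%N].

Lemma unit_ray_neq0 v : unit_ray v -> v <> 0.
Proof. by move=> [_ mv _] v0; move: t_gt0; rewrite -mv v0 mass0 ltxx. Qed.

Lemma extreme_ray_min_face v : unit_ray v -> extreme_ray C (min_face v).
Proof.
move=> uv; have [Cv mv sv] := uv; split; first exact: min_face_is_face.
by rewrite span_dim_min_face ?(maxn_idPl _) //; exact: unit_ray_neq0.
Qed.

Lemma slackZ (c : R) x : 0 < c -> slack (c *: x) = slack x.
Proof.
move=> c0; apply/setP => i; rewrite !inE vecZ massZ mulrCA.
by rewrite pmulr_rgt0 // ltr_pM2l.
Qed.

Lemma extreme_ray_unique F v w : extreme_ray C F -> unit_ray v -> unit_ray w ->
  F v -> F w -> v = w.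
Proof.
move=> eF uv uw Fv Fw; rewrite (extreme_ray_line eF Fw (unit_ray_neq0 uw) Fv).
by case: uv uw => [_ -> _] [_ -> _]; rewrite divff ?scale1r // gt_eqF.
Qed.

Lemma extreme_rayE F v : extreme_ray C F -> F v -> unit_ray v -> F = min_face v.
Proof.
move=> eF Fv uv; apply/seteqP; split; last by apply: min_face_sub => //; case: eF.
move=> y Fy; rewrite (extreme_ray_line eF Fv (unit_ray_neq0 uv) Fy).
have [Cv mv _] := uv.
apply: min_faceZ; last exact: min_face_refl.
rewrite mv divr_ge0 ?(ltW t_gt0) // (@mass_ge0 _ _ t) //.
by case: eF => /face_subset_cone + _; exact.
Qed.

(** The point [x] with [F = min_face x] is non-zero and has at most one slack
    coordinate; rescale it to sum [t]. *)
Lemma extreme_ray_unit F : extreme_ray C F -> exists2 v, F v & unit_ray v.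
Proof.
move=> eF; have [fF dF] := eF; have [x Fx FE] := face_eq_min_face fF.
have Cx := face_subset_cone fF Fx.
move: dF; rewrite (span_dim_face Cx FE); case: eqP => // x0.
move=> /maxn_idPl sx; have mx := mass_gt0 Cx x0.
have c0 : 0 < t / mass x by rewrite divr_gt0.
exists ((t / mass x) *: x).
  by rewrite FE; apply: min_faceZ; [exact: ltW|exact: min_face_refl].
split; [by apply: coneZ => //; exact: ltW| |by rewrite slackZ].
by rewrite massZ divfK // gt_eqF.
Qed.

Lemma min_face_inj v w : unit_ray v -> unit_ray w -> min_face v = min_face w -> v = w.
Proof.
move=> uv uw vw; apply: (extreme_ray_unique (extreme_ray_min_face uv)) => //.
  by apply: min_face_refl; case: uv.
by rewrite vw; apply: min_face_refl; case: uw.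
Qed.

Lemma unit_ray_bounds v i : unit_ray v -> 0 <= (v i : R) /\ (v i : R) <= 1.
Proof.
by move=> [/(_ i)[? h] mv _]; split=> //; rewrite -(ler_pM2l t_gt0) mulr1 -{2}mv.
Qed.

Lemma slack_unit v i : unit_ray v -> (i \in slack v) = (0 < (v i : R) < 1).
Proof. by move=> [_ mv _]; rewrite inE mv -{2}[t]mulr1 ltr_pM2l. Qed.

Lemma slack_sum v w i : unit_ray v -> unit_ray w ->
  (i \in slack (v + w)) = (0 < (v i + w i : R) < 1 + 1).
Proof.
move=> [_ mv _] [_ mw _]; rewrite inE vecD massD mv mw.
by rewrite -{2 3}[t]mulr1 -mulrDr ltr_pM2l.
Qed.

Lemma conic_hull2 (S : set E) (c d : R) v w : 0 <= c -> 0 <= d -> S v -> S w ->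
  conic_hull S (c *: v + d *: w).
Proof.
move=> c0 d0 Sv Sw; exists 2%N, (fun i : 'I_2 => if i == ord0 then c else d).
exists (fun i : 'I_2 => if i == ord0 then v else w).
by split=> [i0|i0|]; [case: ifP|case: ifP|rewrite big_ord_recl big_ord1].
Qed.

Lemma conic_hull_sub (S F : set E) : S `<=` F -> F 0 ->
  (forall x y, F x -> F y -> F (x + y)) -> (forall c x, 0 <= c -> F x -> F (c *: x)) ->
  conic_hull S `<=` F.
Proof.
move=> SF F0 FD FZ _ [n [a [p [a0 Sp ->]]]]; apply: (big_ind F) => // i _.
exact/FZ/SF.
Qed.

(** The hull of the two rays lies in [min_face (v + w)], and it contains [v + w];
    so if it is a face, it is that one.  Conversely, if [min_face (v + w)] has
    dimension 2, each of its points is [c v + d w], and [c < 0] would make [w] a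
    sum of a multiple of [v] and a point of the cone, against its extremality. *)
Lemma adjacent_raysP v w : unit_ray v -> unit_ray w -> v <> w ->
  adjacent_rays C (min_face v) (min_face w) <-> #|slack (v + w)| = 2%N.
Proof.
move=> uv uw vw; have [Cv mv _] := uv; have [Cw mw _] := uw.
have Cs := coneD Cv Cw.
have s0 : v + w <> 0.
  move=> s0; have := massD v w; rewrite s0 mass0 mv mw.
  by move: t_gt0; lra.
rewrite /adjacent_rays; set H := conic_hull _.
have inl : min_face (v + w) v.
  apply: (@face_summand _ v w) => //; exact: min_face_is_face.
have inr : min_face (v + w) w.
  apply: (@face_summand _ w v) => //; [exact: min_face_is_face|].
  by rewrite [w + v]addrC; exact: min_face_refl.
have sub : H `<=` min_face (v + w).
  apply: conic_hull_sub; [|exact: min_face0|by move=> x y; exact: min_faceD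
    |by move=> c x; exact: min_faceZ].
  by move=> x [] /=; apply: min_face_sub => //; exact: min_face_is_face.
have H2 c d : 0 <= c -> 0 <= d -> H (c *: v + d *: w).
  by move=> c0 d0; apply: conic_hull2 => //; [left|right]; exact: min_face_refl.
have dims := span_dim_min_face Cs s0.
split.
  move=> [fH dH]; have HE : H = min_face (v + w).
    apply/seteqP; split=> //; apply: min_face_sub => //.
    by rewrite -[v + w]/(v + w) -{1}[v]scale1r -{1}[w]scale1r; exact: H2.
  by move: dH; rewrite HE dims; case: #|slack _| => [|[|[|]]].
move=> s2; have d2 : span_dim (min_face (v + w)) = 2%N by rewrite dims s2.
suff HE : H = min_face (v + w).
  by split; rewrite HE //; exact: min_face_is_face.
apply/seteqP; split=> // y Fy; have Cy := min_face_cone Fy.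
have [U FU dU] := span_dim_witness (min_face (v + w)).
have fr : free [:: v; w].
  rewrite free_cons span_seq1 seq1_free; apply/andP; split.
    apply/negP => /vlineP[k vk]; apply: vw; have := mv; rewrite vk massZ mw.
    move=> /(canRL (mulfK (lt0r_neq0 t_gt0))); rewrite divff ?gt_eqF // => ->.
    by rewrite scale1r.
  by apply/eqP; exact: unit_ray_neq0.
have : (<<[:: v; w]>> == U)%VS.
  rewrite eqEdim dU d2 (eqP fr) leqnn andbT; apply/span_subvP => z.
  by rewrite !inE => /orP[] /eqP ->; exact: FU.
move=> /eqP vwU; have : y \in <<[:: v; w]>>%VS by rewrite vwU; exact: FU.
rewrite span_cons span_seq1 => /memv_addP[_ /vlineP[c ->] [_ /vlineP[d ->] yE]].
(* stated for both orders of the generators, to bound each coefficient *)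
have key (e f : R) v' w' : unit_ray v' -> unit_ray w' -> v' <> w' ->
    y = e *: v' + f *: w' -> 0 <= e.
  move=> uv' uw' vw' ye; have [Cv' mv' _] := uv'; have [Cw' mw' _] := uw'.
  rewrite leNgt; apply/negP => e0; apply: vw'.
  apply: (extreme_ray_unique (extreme_ray_min_face uw')) => //.
  have ne : 0 < - e by rewrite oppr_gt0.
  have Cy' : C ((- e)^-1 *: y) by apply: coneZ => //; rewrite invr_ge0 ltW.
  apply: (face_summand (min_face_is_face t w') Cv' Cy').
  rewrite ye scalerDr !scalerA invrN mulNr mulVf ?lt_eqF // scaleN1r addNKr.
  apply: min_faceZ; last exact: min_face_refl.
  have := mass_ge0 Cy; rewrite ye massD !massZ mv' mw' -mulrDl pmulr_lge0 // => ef.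
  by rewrite -invrN mulr_ge0 // ?invr_ge0; lra.
rewrite yE; apply: H2; first exact: (key c d v w).
by apply: (key d c w v) => //; [exact: nesym|rewrite addrC].
Qed.

End Rays.

(** * Ray vectors and coordinate permutations *)

Section RayVectors.
Variables (R : realType) (I : finType) (s : R).
Hypotheses (s_gt0 : 0 < s) (s_lt : s + 1 < #|I|%:R).
Local Notation E := (vec R I).
Implicit Types (v w : E) (i k p : I) (P : {set I}).
Local Notation t := (s + 1).
Local Notation C := (hyper_cone t).

Let t_gt0 : 0 < t. Proof. by rewrite addr_gt0. Qed.

Lemma frac_part_bounds (r : R) : 0 <= frac_part r < 1.
Proof. by have := floor_itv r; rewrite /frac_part intrD; lra. Qed.

Lemma frac_part_natD (r c : R) (n : nat) : r = n%:R - 1 + c -> 0 <= c < 1 ->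
  n%:Z = Num.floor r + 1 /\ frac_part r = c.
Proof.
move=> rE c01; have fl : Num.floor r = n%:Z - 1.
  by apply: floor_def; rewrite subrK intrB -pmulrn; lra.
by rewrite /frac_part fl subrK intrB -pmulrn; split=> //; lra.
Qed.

Lemma mass_ray_shape P p (c : R) v : p \notin P ->
  (forall i, v i = if i \in P then 1 else if i == p then c else 0) ->
  mass v = #|P|%:R + c.
Proof.
move=> pP vE; rewrite /mass (bigID (mem P)) /=; congr (_ + _).
  by rewrite (eq_bigr (fun=> 1)) ?sumr_const // => i iP; rewrite vE iP.
rewrite (bigD1 p) //= vE (negPf pP) eqxx big1 ?addr0 // => i /andP[iP ip].
by rewrite vE (negPf iP) (negPf ip).
Qed.

(** With at most one slack coordinate [p], all other coordinates are 0 or 1, and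
    the sum [s + 1] determines the number of ones and the value at [p].  For
    integral [s] there is no slack coordinate, and any zero coordinate serves as
    [p]; there is one because [s + 1 < #|I|]. *)
Lemma ray_vectorP v : ray_vector s v <-> unit_ray t v.
Proof.
split.
  move=> [P [p [cP pP vE]]]; have c01 := frac_part_bounds s.
  have cR : #|P|%:R = (Num.floor s)%:~R + 1 :> R.
    by rewrite -[RHS](intrD _ _ 1) -cP.
  have mv : mass v = t by rewrite (mass_ray_shape pP vE) cR /frac_part; ring.
  split=> //.
    move=> i; rewrite mv vE.
    have [c0 /ltW c1] := andP c01; have t0 := ltW t_gt0.
    by case: ifP => _; [|case: ifP => _]; rewrite ?mulr1 ?mulr0 ?ler_piMr.
  rewrite -(cards1 p); apply: subset_leq_card; apply/fintype.subsetP => i.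
  rewrite !inE mv vE; case: ifP => _; first by rewrite mulr1 ltxx andbF.
  by case: ifP => //; rewrite ltxx.
move=> uv; have [Cv mv sv] := uv.
pose P := [set i | v i == 1 :> R]%SET.
have [p pP vE] : exists2 p, p \notin P &
    forall i, v i = if i \in P then 1 else if i == p then v p else 0.
  have dich i : i \notin slack t v -> i \notin P -> v i = 0.
    rewrite (slack_unit t_gt0) // inE => h vi1; have [v0 v1] := unit_ray_bounds t_gt0 i uv.
    apply/eqP; rewrite eq_le v0 andbT leNgt; apply: contra h => -> /=.
    by rewrite lt_neqAle v1 andbT.
  case: (pickP (mem (slack t v))) => [p /= ps|s0].
    exists p => [|i]; first by move: ps; rewrite (slack_unit t_gt0) // inE; lra.
    case: ifP => [|/negbT iP]; first by rewrite inE => /eqP.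
    case: eqP => [-> //|ip]; apply: dich => //; apply/negP => si; apply: ip.
    by move/card_le1P: sv => /(_ p ps i); rewrite si inE => /esym/eqP.
  have [p pP] : exists p, p \notin P.
    apply/existsP; rewrite -negb_forall; apply/negP => /forallP allP.
    move: s_lt; rewrite -mv /mass (eq_bigr (fun=> 1)) ?sumr_const ?ltxx // => i _.
    by have := allP i; rewrite inE => /eqP.
  exists p => // i; case: ifP => [|/negbT iP]; first by rewrite inE => /eqP.
  by case: eqP => [-> //|_]; apply: dich => //; rewrite -[_ \in _]/(mem _ i) s0.
have vp : 0 <= v p < 1.
  have [-> /= v1] := unit_ray_bounds t_gt0 p uv.
  by rewrite lt_neqAle v1 andbT; move: pP; rewrite inE.
have [|fl fr] := @frac_part_natD s (v p) #|P| _ vp.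
  by have := mass_ray_shape pP vE; rewrite mv; lra.
by exists P, p; split=> //; rewrite fr.
Qed.

Lemma ray_vector_ex (P : {set I}) p : #|P|%:Z = Num.floor s + 1 -> p \notin P ->
  ray_vector s ([ffun i => if i \in P then 1 else if i == p then frac_part s else 0] : E).
Proof. by move=> cP pP; exists P, p; split=> // i; rewrite ffunE. Qed.

Lemma exists_ray_vector : exists v : E, ray_vector s v.
Proof.
have fl : Num.floor s + 1 = `|Num.floor s|.+1%:Z.
  have : 0 <= Num.floor s by rewrite floor_ge0 ltW.
  by lia.
have le : (`|Num.floor s|.+1 < #|I|)%N.
  rewrite -(ltr_nat R) pmulrn -fl intrD (le_lt_trans _ s_lt) //.
  by rewrite lerD2r floor_le.
have : (`|Num.floor s|.+1 <= #|[set: I]%SET|)%N by rewrite cardsT ltnW.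
move=> /card_geqP[r [ur sr _]].
pose P := [set i in r]%SET.
have cP : #|P| = `|Num.floor s|.+1 by rewrite cardsE (card_uniqP ur).
have [p pP] : exists p, p \notin P.
  apply/existsP; rewrite -negb_forall; apply/negP => /forallP allP.
  move: le; rewrite -cP -cardsT ltnNge subset_leq_card //.
  by apply/fintype.subsetP => i _; exact: allP.
eexists; apply: ray_vector_ex pP; by rewrite cP fl.
Qed.

Definition permute_coords (f : I -> I) (x : E) : E := [ffun i => x (f i)].

Lemma permute_coords_linear f : linear (permute_coords f).
Proof. by move=> c x y; apply/ffunP => i; rewrite !ffunE. Qed.

HB.instance Definition _ f :=
  GRing.isLinear.Build R E E _ (permute_coords f) (permute_coords_linear f).

Lemma mass_permute f x : bijective f -> mass (permute_coords f x) = mass x.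
Proof.
move=> bf; rewrite /mass [RHS](reindex f) /=; last exact: onW_bij.
by apply: eq_bigr => i _; rewrite ffunE.
Qed.

Lemma cone_permute f x : bijective f -> C x -> C (permute_coords f x).
Proof. by move=> bf Cx i; rewrite mass_permute // ffunE; exact: Cx. Qed.

Lemma permute_symmetry f : bijective f -> cone_symmetry C (permute_coords f).
Proof.
move=> bf; have [g fK gK] := bf; split=> [x y|].
  rewrite -linearB /enorm; congr Num.sqrt; rewrite /dotp [RHS](reindex f) /=; last exact: onW_bij.
  by apply: eq_bigr => i _; rewrite ffunE.
apply/seteqP; split=> [_ [x Cx <-]|x Cx] /=; first exact: cone_permute.
exists (permute_coords g x); last by apply/ffunP => i; rewrite !ffunE fK.
by apply: cone_permute => //; exists f.
Qed.

Lemma min_face_permute f x : bijective f ->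
  permute_coords f @` min_face t x = min_face t (permute_coords f x).
Proof.
move=> bf; have [g fK gK] := bf; apply/seteqP; split=> [_ [y [Cy Hy] <-]|y [Cy Hy]] /=.
  split=> [|i]; first exact: cone_permute.
  by rewrite !mass_permute // !ffunE; exact: Hy.
have bg : bijective g by exists f.
exists (permute_coords g y); last by apply/ffunP => i; rewrite !ffunE fK.
split=> [|i]; first exact: cone_permute.
by have := Hy (g i); rewrite !mass_permute // !ffunE gK.
Qed.

(** List the coordinates with the ones first, then the position of
    [frac_part s], then the zeros.  Both vectors read the same along their
    lists, so matching the lists gives the permutation. *)
Lemma ray_vectors_permute v w : ray_vector s v -> ray_vector s w ->
  exists2 f : I -> I, bijective f & w = permute_coords f v.
Proof.
move=> [P [p [cP pP vE]]] [Q [q [cQ qQ wE]]].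
have PQ : #|P| = #|Q| by apply/eqP; rewrite -eqz_nat cP cQ.
pose lay (S : {set I}) r := enum S ++ r :: enum (~: (r |: S)).
have lay_mem S r i : i \in lay S r.
  by rewrite mem_cat inE !mem_enum !inE; case: (i \in S); case: (i == r).
have lay_uniq (S : {set I}) r : r \notin S -> uniq (lay S r).
  move=> rS; rewrite cat_uniq /= !enum_uniq. rewrite andbT /= mem_enum (negPf rS) /=.
  rewrite mem_enum !inE eqxx andbT; apply/hasPn => i; rewrite !mem_enum !inE negb_or.
  by case/andP.
have lay_map (x : E) (S : {set I}) r : r \notin S ->
    (forall i, x i = if i \in S then 1 else if i == r then frac_part s else 0) ->
    map x (lay S r) = nseq #|S| 1 ++ frac_part s :: nseq (#|I| - #|S|.+1) 0.
  move=> rS xE; rewrite map_cat /= xE (negPf rS) eqxx.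
  have szC : size (enum (~: (r |: S))) = (#|I| - #|S|.+1)%N.
    by rewrite -cardE cardsCs finset.setCK cardsU1 rS.
  rewrite -szC cardE -2!(size_map x); congr (_ ++ _ :: _).
    by apply/all_pred1P/allP => _ /mapP[i + ->]; rewrite mem_enum /= xE => ->.
  apply/all_pred1P/allP => _ /mapP[i + ->]; rewrite mem_enum /= xE !inE negb_or.
  by move=> /andP[/negPf -> /negPf ->].
have size_lay (S : {set I}) r : r \notin S -> size (lay S r) = #|I|.
  by move=> rS; rewrite -(card_uniqP (lay_uniq S r rS)); apply: eq_card => i; rewrite lay_mem inE.
have maps : map v (lay P p) = map w (lay Q q).
  by rewrite (lay_map v) // (lay_map w) // PQ.
pose f i := nth p (lay P p) (index i (lay Q q)).
have lt i : (index i (lay Q q) < #|I|)%N by rewrite -(size_lay Q q qQ) index_mem.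
exists f.
  apply: injF_bij => i k /eqP; rewrite nth_uniq ?size_lay ?lay_uniq // => /eqP ik.
  by rewrite -[i](nth_index p (lay_mem Q q i)) ik nth_index.
apply/ffunP => i; rewrite ffunE -(nth_map _ (v p)) ?size_lay // maps.
by rewrite (nth_map p) ?size_lay // nth_index.
Qed.

Lemma one_orbit F G : extreme_ray C F -> extreme_ray C G ->
  exists2 f : {linear E -> E}, cone_symmetry C f & G = f @` F.
Proof.
move=> eF eG; have [v Fv uv] := extreme_ray_unit t_gt0 eF.
have [w Gw uw] := extreme_ray_unit t_gt0 eG.
have [f bf wE] := ray_vectors_permute ((ray_vectorP v).2 uv) ((ray_vectorP w).2 uw).
exists (permute_coords f); first exact: permute_symmetry.
by rewrite (extreme_rayE t_gt0 eG Gw uw) (extreme_rayE t_gt0 eF Fv uv) min_face_permute // wE.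
Qed.

Lemma face_orbit_sub F G (f : {linear E -> E}) : cone_symmetry C f -> G = f @` F ->
  face_orbit C G `<=` face_orbit C F.
Proof.
move=> [fi fC] GE _ [h [[hi hC] ->]]; exists (h \o f); split; last by rewrite GE image_comp.
by split=> [x y|]; [rewrite /= hi fi|rewrite -[LHS](image_comp f h) fC].
Qed.

End RayVectors.

(** * Facets and their adjacency *)

Section Facets.
Variables (R : realType) (I : finType) (t : R).
Hypotheses (t_gt1 : 1 < t) (t_lt : t < #|I|%:R) (I_ge3 : (3 <= #|I|)%N).
Local Notation E := (vec R I).
Implicit Types (x y z : E) (i j k : I) (F G : set E) (Z B : {set I}) (b : bool).
Local Notation C := (hyper_cone t).
Local Notation slack := (slack t).
Local Notation min_face := (min_face t).

Let t_gt0 : 0 < t. Proof. exact: lt_trans t_gt1. Qed.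

Lemma cut_slack Z B z : cut t Z B z -> slack z \subset ~: (Z :|: B).
Proof.
move=> [_ zZ zB]; apply/fintype.subsetP => i; rewrite !inE negb_or => /andP[z0 zt].
apply/andP; split; apply/negP.
  by move=> /zZ zi; rewrite zi ltxx in z0.
by move=> /zB zi; rewrite zi ltxx in zt.
Qed.

(** At a point where all the other inequalities are strict, the tight ones are
    exactly those that define the cut. *)
Lemma cut_eq_min_face Z B z : fintype.disjoint (mem Z) (mem B) -> cut t Z B z -> z <> 0 ->
  slack z = ~: (Z :|: B) -> cut t Z B = min_face z.
Proof.
move=> dZB cz z0 sz; have [Cz zZ zB] := cz; apply/seteqP; split=> y.
  move=> [Cy yZ yB]; split=> // i; have := mass_gt0 Cz z0 => mz.
  have [si|] := boolP (i \in slack z).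
    by move: si; rewrite inE => /andP[/gt_eqF/eqP ? /lt_eqF/eqP ?].
  rewrite sz !inE negbK => /orP[iZ|iB]; split=> h; try exact: yZ; try exact: yB.
    by move: mz; rewrite -h zZ // mulr0 ltxx.
  by move: mz; rewrite -(zB i iB) h mulr0 ltxx.
move=> [Cy Hy]; split=> // i iJ; first by apply: (Hy i).1; exact: zZ.
by apply: (Hy i).2; exact: zB.
Qed.

Section Strata.
Variables (Z B : {set I}).
Hypotheses (dZB : fintype.disjoint (mem Z) (mem B)) (ltZB : (#|Z| + #|B| < #|I|)%N).

Let cardZB : #|~: (Z :|: B)| = (#|I| - (#|Z| + #|B|))%N.
Proof. by rewrite cardsCs finset.setCK cardsU (disjoint_setI0 dZB) cards0 subn0. Qed.

Let cardZBR : #|~: (Z :|: B)|%:R = #|I|%:R - #|Z|%:R - #|B|%:R :> R.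
Proof. by rewrite cardZB natrB ?natrD; [ring|exact: ltnW]. Qed.

Lemma mass_cut y : mass y = \sum_(i in Z) y i + \sum_(i in B) y i +
  \sum_(i in ~: (Z :|: B)) y i.
Proof.
rewrite /mass (bigID (mem (Z :|: B))) /=; congr (_ + _).
  by rewrite -bigU //; apply: eq_bigl => i; rewrite !inE.
by apply: eq_bigl => i; rewrite finset.in_setC.
Qed.

(** Give the value 0 on [Z], 1 on [B], and spread the rest [t - #|B|] of the sum
    [t] evenly; the bounds on [t] say that the common value [c] lies strictly
    between 0 and 1. *)
Lemma cut_open_point : #|B|%:R < t -> t < #|I|%:R - #|Z|%:R ->
  exists2 z, cut t Z B z /\ z <> 0 & slack z = ~: (Z :|: B).
Proof.
move=> Bt tZ; pose D := ~: (Z :|: B).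
have D0 : 0 < #|D|%:R :> R by rewrite ltr0n cardZB subn_gt0.
pose c := (t - #|B|%:R) / #|D|%:R.
pose z : E := [ffun i => if i \in Z then 0 else if i \in B then 1 else c].
have zZ i : i \in Z -> z i = 0 by rewrite ffunE => ->.
have zB i : i \in B -> z i = 1.
  by move=> iB; rewrite ffunE iB (disjointFl dZB).
have zD i : i \in D -> z i = c.
  by rewrite !inE negb_or ffunE => /andP[/negPf -> /negPf ->].
have mz : mass z = t.
  rewrite mass_cut (eq_bigr (fun=> 0) zZ) (eq_bigr (fun=> 1) zB) (eq_bigr (fun=> c) zD).
  rewrite big1 // add0r !sumr_const -[c *+ _]mulr_natr divfK ?gt_eqF //.
  by rewrite addrC subrK.
have c0 : 0 < c by rewrite divr_gt0 // subr_gt0.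
have c1 : c < 1 by rewrite ltr_pdivrMr // mul1r cardZBR; lra.
have cut_z : cut t Z B z.
  split=> // [i|i iB]; last by rewrite mz zB // mulr1.
  rewrite mz ffunE; case: ifP => _; first by rewrite mulr0 lexx ltW.
  by case: ifP => _; rewrite ?mulr1 ?ler01 ?lexx // (ltW c0) ler_piMr // ltW.
exists z; first by split=> // z0; move: t_gt0; rewrite -mz z0 mass0 ltxx.
apply/eqP; rewrite finset.eqEsubset cut_slack //=; apply/fintype.subsetP => i iD.
by rewrite inE mz zD // c0 /= gtr_pMr.
Qed.

(** The slack coordinates have a positive sum, which gives the first bound, and
    each is below a [1 / t] share of the total, which gives the second. *)
Lemma cut_open_bounds z : cut t Z B z -> slack z = ~: (Z :|: B) ->
  #|B|%:R < t /\ t < #|I|%:R - #|Z|%:R.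
Proof.
move=> [Cz zZ zB] sz; pose D := ~: (Z :|: B).
have : (0 < #|D|)%N by rewrite cardZB subn_gt0.
move=> /card_gt0P[k kD].
have zD i : i \in D -> 0 < (z i : R) /\ t * z i < mass z.
  by move=> iD; have := iD; rewrite /D -sz inE => /andP.
have m0 : 0 < mass z by have [zk tz] := zD k kD; apply: lt_trans tz; rewrite mulr_gt0.
have mE : t * mass z = #|B|%:R * mass z + \sum_(i in D) t * z i.
  rewrite {1}mass_cut !mulrDr !(mulr_sumr _ _ _ t) big1 ?add0r => [|i /zZ ->]; last by rewrite mulr0.
  by rewrite (eq_bigr (fun=> mass z) zB) sumr_const mulr_natl.
have l : 0 < \sum_(i in D) t * z i.
  rewrite (bigD1 k) //= ltr_wpDr ?sumr_ge0 // => [i /andP[/zD[zi _] _]|].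
    by rewrite mulr_ge0 ?ltW.
  by rewrite mulr_gt0 //; case: (zD k kD).
have u : \sum_(i in D) t * z i < #|D|%:R * mass z.
  rewrite mulr_natl -sumr_const; apply: ltr_sum => [|i /zD[] //].
  apply/hasP; exists k => //; exact: mem_index_enum.
split; first by rewrite -(ltr_pM2r m0) mE ltrDl.
by rewrite -(ltr_pM2r m0) mE -ltrBrDl -mulrBl -cardZBR.
Qed.

Lemma span_dim_cut : #|B|%:R < t -> t < #|I|%:R - #|Z|%:R ->
  span_dim (cut t Z B) = (#|I| - (#|Z| + #|B|))%N.
Proof.
move=> Bt tZ; have [z [cz z0] sz] := cut_open_point Bt tZ.
have [Cz _ _] := cz.
rewrite (cut_eq_min_face dZB cz z0 sz) span_dim_slack // sz cardZB //.
by rewrite subn_gt0.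
Qed.

(** The cut is a face, hence some [min_face z].  If the dimension is at least 2
    it counts the slack coordinates of [z], so all those outside [Z :|: B] are
    slack.  Dimension 1 has to be excluded, since the vertices also have it. *)
Lemma span_dim_cut_inv : ((#|Z| + #|B|).+2 <= #|I|)%N ->
  span_dim (cut t Z B) = (#|I| - (#|Z| + #|B|))%N ->
  #|B|%:R < t /\ t < #|I|%:R - #|Z|%:R.
Proof.
move=> le2 dF; have [z cz FE] := face_eq_min_face (cut_is_face t Z B).
have Cz : C z by case: cz.
move: dF; rewrite (span_dim_face t_gt0 Cz FE); case: eqP => z0 dF.
  by move: dF ltZB; lia.
apply: (cut_open_bounds cz); apply/eqP; rewrite eqEcard cut_slack //= cardZB.
by move: dF le2; rewrite /maxn; case: ltnP; lia.
Qed.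

End Strata.

(** The inequality [(i, true)] is [0 <= x i], and [(i, false)] is
    [t * x i <= mass x]. *)
Definition zeros (ib : I * bool) : {set I} :=
  if ib.2 then [set ib.1]%SET else finset.set0.
Definition tights (ib : I * bool) : {set I} :=
  if ib.2 then finset.set0 else [set ib.1]%SET.
Definition facet_cut ib : set E := cut t (zeros ib) (tights ib).

Lemma disjoint_zeros_tights ib : fintype.disjoint (mem (zeros ib)) (mem (tights ib)).
Proof.
rewrite -setI_eq0 /zeros /tights.
by case: ib.2; rewrite (finset.setI0, finset.set0I) eqxx.
Qed.

Lemma zerosU_tights ib : zeros ib :|: tights ib = [set ib.1]%SET.
Proof. by rewrite /zeros /tights; case: ib.2; rewrite (finset.setU0, finset.set0U). Qed.

Lemma card_zeros ib : #|zeros ib| = ib.2.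
Proof. by rewrite /zeros; case: ib.2; rewrite (cards1, cards0). Qed.

Lemma card_tights ib : #|tights ib| = ~~ ib.2.
Proof. by rewrite /tights; case: ib.2; rewrite (cards1, cards0). Qed.

Lemma facet_cutP ib y : facet_cut ib y <->
  C y /\ (if ib.2 then y ib.1 = 0 else t * y ib.1 = mass y).
Proof.
rewrite /facet_cut /zeros /tights; case: ib => i b; split=> [[Cy yZ yB]|[Cy Hy]].
  by split=> //; case: b yZ yB => /= yZ yB; [apply: yZ|apply: yB]; rewrite inE.
by split=> // j; case: b Hy => /= Hy; rewrite inE // => /eqP ->.
Qed.

(** A facet is [min_face x] for a point [x] with all coordinates slack but one,
    and that coordinate is 0 or maximal. *)
Lemma facetP F : facet C F ->
  exists2 ib, F = facet_cut ib & exists2 z, F z & slack z = ~: [set ib.1]%SET.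
Proof.
move=> [fF dF]; have [x Fx FE] := face_eq_min_face fF.
have Cx := face_subset_cone fF Fx.
move: dF; rewrite (span_dim_cone t_gt0 t_lt) (span_dim_face t_gt0 Cx FE).
case: eqP => [_|x0]; first by move: I_ge3; lia.
move=> dx; have cs : #|slack x|.+1 = #|I| by move: dx I_ge3; rewrite /maxn; case: ltnP; lia.
have /eqP/cards1P[i si] : #|~: slack x| = 1%N by rewrite cardsCs finset.setCK; lia.
have sx : slack x = ~: [set i]%SET by rewrite -si finset.setCK.
have : i \notin slack x by rewrite sx !inE eqxx.
rewrite slackE // => iP.
have cx : facet_cut (i, x i == 0 :> R) x.
  by apply/facet_cutP; split=> //=; move: iP; case: eqP => //= _ /eqP.
exists (i, x i == 0 :> R); last by exists x.
rewrite FE /facet_cut; symmetry; apply: cut_eq_min_face => //.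
  exact: disjoint_zeros_tights.
by rewrite zerosU_tights.
Qed.

Lemma facet_cut_facet (ib : I * bool) : (ib.2 -> t < #|I|%:R - 1) -> facet C (facet_cut ib).
Proof.
move=> tb; split; first exact: cut_is_face.
have cc : (#|zeros ib| + #|tights ib| = 1)%N.
  by rewrite card_zeros card_tights; case: ib.2.
rewrite span_dim_cone // span_dim_cut ?disjoint_zeros_tights ?cc //; try by move: I_ge3; lia.
  by rewrite card_tights; case: ib.2; rewrite // (lt_trans _ t_gt1).
by rewrite card_zeros; case: ib.2 tb; rewrite ?subr0 // => ->.
Qed.

Lemma facet_zero F i : facet C F -> F = facet_cut (i, true) -> t < #|I|%:R - 1.
Proof.
move=> [fF dF] FE.
have cc : (#|zeros (i, true)| + #|tights (i, true)| = 1)%N.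
  by rewrite card_zeros card_tights.
have [|||| _] := @span_dim_cut_inv (zeros (i, true)) (tights (i, true)).
- exact: disjoint_zeros_tights.
- by rewrite cc; move: I_ge3; lia.
- by rewrite cc; move: I_ge3; lia.
- move: dF; rewrite FE (span_dim_cone t_gt0 t_lt) cc => dF.
  by rewrite -[cut _ _ _]/(facet_cut (i, true)); lia.
by rewrite card_zeros.
Qed.

Lemma facet_cut_open ib : facet C (facet_cut ib) ->
  exists2 z, facet_cut ib z & slack z = ~: [set ib.1]%SET.
Proof.
move=> /facetP[jc _ [z cz sz]]; exists z => //.
have /fintype.subsetP/(_ jc.1) := cut_slack cz.
rewrite sz zerosU_tights; case: (eqVneq jc.1 ib.1) => [-> //|ne].
have /fintype.subsetP/(_ ib.1) := cut_slack cz.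
by rewrite sz zerosU_tights !inE eqxx eq_sym ne => /(_ isT).
Qed.

(** A facet has a point where no other inequality is tight, so it determines
    its inequality. *)
Lemma facet_cut_inj ib jc : facet C (facet_cut ib) -> facet_cut ib = facet_cut jc -> ib = jc.
Proof.
move=> /facet_cut_open[z cz sz] ibjc; have cz' := cz; rewrite ibjc in cz'.
have e : jc.1 = ib.1.
  apply/eqP; apply/negPn/negP => ne; have /fintype.subsetP/(_ jc.1) := cut_slack cz'.
  by rewrite sz zerosU_tights !inE eqxx ne => /(_ isT).
case: ib jc e ibjc cz cz' sz => [i b] [_ c] /= -> _ /facet_cutP[/= Cz zb] /facet_cutP[/= _ zc] sz.
have [-> //|bc] := eqVneq b c.
have mz : mass z = 0.
  by case: b c bc zb zc => [] [] //= _ h h'; [rewrite -h' h|rewrite -h h']; rewrite mulr0.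
have : slack z = finset.set0.
  by apply/setP => k; rewrite (mass_eq0 Cz mz) !inE vec0 ltxx.
rewrite sz => /(congr1 (fun A : {set I} => #|A|)); rewrite cards0 cardsC1.
by move: I_ge3; lia.
Qed.

Lemma cutI (Z B Z' B' : {set I}) : cut t Z B `&` cut t Z' B' = cut t (Z :|: Z') (B :|: B').
Proof.
apply/seteqP; split=> y.
  by move=> [[Cy yZ yB] [_ yZ' yB']]; split=> // i; rewrite inE => /orP[]; auto.
by move=> [Cy yZ yB]; split; split=> // i h; [apply: yZ|apply: yB|apply: yZ|apply: yB];
   rewrite inE h ?orbT.
Qed.

(** A coordinate that is both 0 and maximal forces the sum to vanish, so the two
    facets meet in the origin alone. *)
Lemma not_adjacent_parallel i b c : facet C (facet_cut (i, b)) ->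
  ~ adjacent_facets C (facet_cut (i, b)) (facet_cut (i, c)).
Proof.
move=> [_ dF]; rewrite /adjacent_facets; have [<-|bc] := eqVneq b c.
  by rewrite setIid -dF; lia.
suff -> : facet_cut (i, b) `&` facet_cut (i, c) = [set 0].
  by rewrite span_dim0 span_dim_cone //; move: I_ge3; lia.
apply/seteqP; split=> [y|_ ->] /=.
  move=> [/facet_cutP[/= Cy yb] /facet_cutP[/= _ yc]]; apply: (mass_eq0 Cy).
  by case: b dF c bc yb yc => [] _ [] //= _ h h'; [rewrite -h' h|rewrite -h h']; rewrite mulr0.
by split; apply/facet_cutP; split; [exact: cone0|case: ifP|exact: cone0|case: ifP];
  rewrite /= ?mass0 ?vec0 ?mulr0.
Qed.

(** The hypothesis [4 <= #|I|] makes the expected dimension of the intersection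
    at least 2; in dimension 1 the intersection could also be a single ray
    without slack coordinates. *)
Lemma adjacent_facet_cuts i j b c : i <> j -> (4 <= #|I|)%N ->
  adjacent_facets C (facet_cut (i, b)) (facet_cut (j, c)) <->
  (~~ b + ~~ c)%:R < t /\ t < #|I|%:R - (b + c)%:R.
Proof.
move=> ij I_ge4; rewrite /adjacent_facets cutI (span_dim_cone t_gt0 t_lt).
set Z := _ :|: _; set B := _ :|: _.
have cZ : #|Z| = (b + c)%N.
  rewrite /Z /zeros /=; case: (b); case: (c); rewrite ?finset.setU0 ?finset.set0U ?cards1 ?cards0 //.
  by rewrite cards2; move/eqP: ij => ->.
have cB : #|B| = (~~ b + ~~ c)%N.
  rewrite /B /tights /=; case: (b); case: (c); rewrite ?finset.setU0 ?finset.set0U ?cards1 ?cards0 //.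
  by rewrite cards2; move/eqP: ij => ->.
have dZB : fintype.disjoint (mem Z) (mem B).
  rewrite -setI_eq0; apply/eqP/setP => k; rewrite /Z /B /zeros /tights !inE /=.
  by case: (b); case: (c); rewrite !inE ?orbF ?andbF //=; apply/negP => /andP[/eqP -> /eqP];
    move=> // /esym.
have c2 : (#|Z| + #|B| = 2)%N by rewrite cZ cB; case: (b); case: (c).
rewrite -cZ -cB; split=> [dF|[Bt tZ]].
  by apply: span_dim_cut_inv => //; rewrite c2; move: I_ge4 dF; lia.
by rewrite span_dim_cut ?c2 //; move: I_ge4; lia.
Qed.

(** If [2 < t] the cut has the expected dimension.  Otherwise [t = 2] and
    [#|I| = 3], and the two facets meet in the ray of a vertex without slack
    coordinates, which still has the expected dimension 1. *)
Lemma adjacent_tight_facets i j : i <> j -> #|I|%:R - 1 <= t ->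
  adjacent_facets C (facet_cut (i, false)) (facet_cut (j, false)).
Proof.
move=> ij tN; rewrite /adjacent_facets cutI (span_dim_cone t_gt0 t_lt).
rewrite {1}/zeros /= finset.setU0 /tights /=; set B : {set I} := _ :|: _.
have cB : #|B| = 2%N by rewrite cards2; move/eqP: ij => ->.
have d0B : fintype.disjoint (mem (finset.set0 : {set I})) (mem B).
  by rewrite -setI_eq0 finset.set0I.
have [t2|t2] := ltP (2 : R) t.
  by rewrite span_dim_cut ?cards0 ?cB //; [rewrite add0n -addn2 subnK // ltnW|rewrite subr0].
have I3 : #|I| = 3%N.
  have : #|I|%:R <= 3 :> R by lra.
  by rewrite (ler_nat R _ 3); move: I_ge3; lia.
have tE : t = 2 by apply/le_anti; rewrite t2 /=; move: tN; rewrite I3; lra.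
pose z : E := [ffun k => (k \in B)%:R].
have mz : mass z = 2.
  rewrite /mass (eq_bigr (fun k => (k \in B)%:R)) => [|k _]; last by rewrite ffunE.
  by rewrite -natr_sum -big_mkcond /= sum1_card cB.
have Cz : C z.
  by move=> k; rewrite mz ffunE tE; case: (k \in B); rewrite /= ?mulr1 ?mulr0 ?lexx ?ler01 ?ler0n.
have z0 : z <> 0 by move=> z0; move: mz; rewrite z0 mass0; lra.
have sz : #|slack z| = 0%N.
  apply: eq_card0 => k; rewrite !inE mz ffunE tE.
  by case: (k \in B); rewrite /= ?mulr1 ?ltxx ?andbF.
have Fz : cut t finset.set0 B z.
  by split=> // [k|k kB]; [rewrite inE|rewrite ffunE kB mz mulr1].
suff -> : cut t finset.set0 B = min_face z by rewrite span_dim_ray // I3.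
apply/seteqP; split; last by apply: min_face_sub => //; exact: cut_is_face.
move=> y [Cy y0 yB]; split=> // k; rewrite mz ffunE.
have [kB|kB] := boolP (k \in B); first by split=> [/eqP|_]; [rewrite oner_eq0|exact: yB].
split=> [_|/eqP]; last by rewrite mulr0 eq_sym pnatr_eq0.
have : \sum_(l in ~: (finset.set0 :|: B)) y l = 0.
  have := mass_cut d0B y; rewrite big_set0 add0r.
  suff -> : \sum_(l in B) y l = mass y by move=> e; apply: (addrI (mass y)); rewrite addr0 -e.
  apply: (mulfI (lt0r_neq0 t_gt0)); rewrite mulr_sumr.
  by rewrite (eq_bigr (fun=> mass y) yB) sumr_const cB tE mulr_natl.
move=> /eqP; rewrite psumr_eq0 => [/allP/(_ k (mem_index_enum _))|l _]; last by case: (Cy l).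
by rewrite finset.set0U finset.in_setC kB => /eqP.
Qed.

End Facets.

(** * The orbit of extreme rays and the skeleton graph *)

(** It suffices to give the bijection in the other direction, from the
    combinatorial graph to the geometric one; [h0] is the value of the inverse
    outside of the vertex set. *)
Lemma graph_iso_from (G H : graph) (h0 : vertex_type H)
    (g : vertex_type H -> vertex_type G) :
  (forall x, vertices H x -> vertices G (g x)) ->
  (forall x y, vertices H x -> vertices H y -> g x = g y -> x = y) ->
  (forall F, vertices G F -> exists2 x, vertices H x & g x = F) ->
  (forall x y, vertices H x -> vertices H y -> (adj H x y <-> adj G (g x) (g y))) ->
  graph_iso G H.
Proof.
move=> gV gI gS gA.
have [f fP] : {f : vertex_type G -> vertex_type H &
    forall F, vertices G F -> vertices H (f F) /\ g (f F) = F}.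
  apply: (@choice _ _ (fun F x => vertices G F -> vertices H x /\ g x = F)) => F.
  have [/gS[x Hx gx]|nF] := pselect (vertices G F); first by exists x.
  by exists h0.
exists f; split; first split.
- by move=> F /fP[].
- move=> F F'; rewrite !inE => /fP[_ {2}<-] /fP[_ {2}<-] -> //.
- move=> x Hx; have Gx := gV x Hx; exists (g x) => //.
  by have [Hf gf] := fP _ Gx; apply: gI.
move=> F F' /fP[Hf {1}<-] /fP[Hf' {1}<-].
by split=> /gA; apply.
Qed.

Lemma graph_iso_trans (G H K : graph) : graph_iso G H -> graph_iso H K -> graph_iso G K.
Proof.
move=> [f [bf fA]] [g [bg gA]]; exists (g \o f); split; first exact: set_bij_comp bf bg.
move=> x y Gx Gy; rewrite fA // gA //; have [+ _ _] := bf; exact.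
Qed.

Section SkeletonAndRidges.
Variables (R : realType) (I : finType) (s : R) (n : nat) (h : 'I_n -> I).
Hypotheses (s_gt0 : 0 < s) (s_lt : s + 1 < n%:R) (h_bij : bijective h).
Local Notation E := (vec R I).
Implicit Types (v w : E) (i k p q : I) (F G : set E).
Local Notation t := (s + 1).
Local Notation C := (hyper_cone t : set E).

Let cardI : #|I| = n.
Proof. by rewrite -[RHS]card_ord; apply/esym/bij_eq_card/h_bij. Qed.

Let t_gt0 : 0 < t. Proof. by rewrite addr_gt0. Qed.
Let t_gt1 : 1 < t. Proof. by rewrite ltrDr. Qed.
Let s_ltI : t < #|I|%:R. Proof. by rewrite cardI. Qed.

Lemma not_adjacent_self F : extreme_ray C F -> ~ adjacent_rays C F F.
Proof.
move=> eF [_ d2]; have [v Fv uv] := extreme_ray_unit t_gt0 eF.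
have : (span_dim (conic_hull (F `|` F)) <= span_dim F)%N.
  apply: span_dim_le; rewrite setUid (extreme_rayE t_gt0 eF Fv uv).
  by apply: conic_hull_sub => //; [exact: min_face0|move=> *; exact: min_faceD|
    move=> *; exact: min_faceZ].
by rewrite d2; case: eF => _ ->.
Qed.

Lemma unique_orbit : exists! O, exists F, extreme_ray C F /\ O = face_orbit C F.
Proof.
have [v /(ray_vectorP s_gt0 s_ltI) uv] := exists_ray_vector s_gt0 s_ltI.
have eF := extreme_ray_min_face t_gt0 uv; set F := min_face t v in eF.
exists (face_orbit C F); split; first by exists F.
move=> _ [G [eG ->]].
have [f sf GE] := one_orbit s_gt0 s_ltI eF eG.
have [g sg FE] := one_orbit s_gt0 s_ltI eG eF.
by apply/seteqP; split; [exact: (face_orbit_sub sg FE)|exact: (face_orbit_sub sf GE)].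
Qed.

Lemma skeleton_iso (K : graph) (x0 : vertex_type K)
    (r : vertex_type K -> E) :
  (forall x, vertices K x -> unit_ray t (r x)) ->
  (forall x y, vertices K x -> vertices K y -> r x = r y -> x = y) ->
  (forall v, unit_ray t v -> exists2 x, vertices K x & r x = v) ->
  (forall x y, vertices K x -> vertices K y ->
     (adj K x y <-> x <> y /\ #|slack t (r x + r y)| = 2%N)) ->
  graph_iso (skeleton_graph C) K.
Proof.
move=> rV rI rS rA.
apply: (@graph_iso_from (skeleton_graph C) K x0 (fun x => min_face t (r x))) => /=.
- by move=> x /rV; exact: extreme_ray_min_face.
- by move=> x y Kx Ky xy; apply: rI => //; apply: (min_face_inj t_gt0) xy; exact: rV.
- move=> F eF; have [v Fv uv] := extreme_ray_unit t_gt0 eF.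
  have [x Kx rx] := rS v uv; exists x => //.
  by rewrite rx (extreme_rayE t_gt0 eF Fv uv).
move=> x y Kx Ky; rewrite rA //; have [<-|xy] := pselect (x = y).
  split=> [[] //|] /not_adjacent_self; case.
  by apply: extreme_ray_min_face => //; exact: rV.
rewrite adjacent_raysP //; [tauto|exact: rV|exact: rV|].
by move=> /rI; auto.
Qed.

(** For integral [s] the generators are the indicators of the sets of [s + 1]
    coordinates, and the slack coordinates of a sum of two indicators form the
    symmetric difference of the sets. *)
Lemma johnson_skeleton (k : nat) : s = k%:R ->
  graph_iso (skeleton_graph C) (johnson_graph n k.+1).
Proof.
move=> sk; pose r (A : {set 'I_n}) : E := [ffun i => (i \in h @: A)%:R].
have tk : t = k.+1%:R by rewrite sk -natr1.
have mr (A : {set 'I_n}) : #|A| = k.+1 -> mass (r A) = t.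
  move=> cA; rewrite /mass (eq_bigr (fun i => (i \in h @: A)%:R)) => [|i _]; last by rewrite ffunE.
  by rewrite -natr_sum -big_mkcond /= sum1_card card_imset ?cA //; exact: bij_inj.
have fk : Num.floor s = k by rewrite sk pmulrn intrKfloor.
have f0 : frac_part s = 0 by rewrite /frac_part fk sk subrr.
have rP (A : {set 'I_n}) : #|A| = k.+1 -> unit_ray t (r A).
  move=> cA; split; [move=> i|exact: mr|].
    by rewrite mr // ffunE; case: (_ \in _); rewrite ?mulr1 ?mulr0 ?ler01 ?lexx // ltW.
  rewrite (_ : slack _ _ = finset.set0) ?cards0 //; apply/setP => i.
  rewrite !inE mr // ffunE.
  by case: (i \in h @: A); rewrite ?mulr1 ?mulr0 ltxx ?andbF.
have rI A B : r A = r B -> A = B.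
  move=> /ffunP rAB; apply: (imset_inj (bij_inj h_bij)); apply/setP => i.
  have := rAB i; rewrite !ffunE => /eqP; rewrite eqr_nat.
  by case: (_ \in _); case: (_ \in _).
apply: (@skeleton_iso (johnson_graph n k.+1) finset.set0 r) => //=.
- by move=> A B _ _; exact: rI.
- move=> v /(ray_vectorP s_gt0 s_ltI)[P [p [cP pP vE]]].
  have [g hK gK] := h_bij.
  have hP : h @: (h @^-1: P) = P.
    apply/setP => i; apply/imsetP/idP => [[j + ->]|iP]; first by rewrite inE.
    by exists (g i); rewrite ?inE gK.
  exists (h @^-1: P).
    by rewrite -(card_imset _ (bij_inj h_bij)) hP; move: cP; rewrite fk; lia.
  by apply/ffunP => i; rewrite ffunE hP vE f0 if_same; case: ifP.
move=> A B cA cB.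
have sl : slack t (r A + r B) = h @: ((A :\: B) :|: (B :\: A)).
  have ij := bij_inj h_bij; have [g hK gK] := h_bij.
  apply/setP => i; rewrite -[i]gK slack_sum ?mem_imset ?inE //; [|exact: rP|exact: rP].
  rewrite !ffunE !mem_imset //.
  by case: (_ \in A); case: (_ \in B); rewrite /= ?addr0 ?add0r ?ltr01 ?ltxx ?andbF ?ltr_pwDr.
rewrite sl card_imset; last exact: bij_inj.
have c2 : #|A :\: B :|: B :\: A| = (#|A :\: B| + #|B :\: A|)%N.
  rewrite cardsU (_ : _ :&: _ = finset.set0) ?cards0 ?subn0 //.
  by apply/setP => i; rewrite !inE; case: (i \in A); case: (i \in B).
have := cardsID B A; have := cardsID A B; rewrite finset.setIC c2 cA cB.
move=> e1 e2; split=> [e|[_]]; last first.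
  by move: e1 e2; move: #|A :&: B| #|A :\: B| #|B :\: A| => x a b; clear; lia.
split; first by move=> AB; move: e; rewrite AB finset.setIid cB => /eqP; rewrite gtn_eqF.
by move: e e1 e2; move: #|A :&: B| #|A :\: B| #|B :\: A| => x a b; clear; lia.
Qed.

(** Here a generator has ones everywhere but at one coordinate, so two of them
    differ in exactly two coordinates. *)
Lemma simplex_skeleton : n%:R - 2 <= s -> (1 < n)%N ->
  graph_iso (skeleton_graph C) (complete_graph n).
Proof.
move=> sn n_gt1; pose c : R := s - (n%:R - 2).
have [c0 c1] : 0 <= c /\ c < 1 by rewrite /c; move: s_lt; split; lra.
pose r (j : 'I_n) : E := [ffun i => if i == h j then c else 1].
have mr j : mass (r j) = t.
  rewrite /mass (bigD1 (h j)) //= ffunE eqxx.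
  rewrite (eq_bigr (fun=> 1)) => [|i /negPf ij]; last by rewrite ffunE ij.
  rewrite sumr_const cardC1 cardI /c -subn1 natrB; [lra|exact: ltnW].
have rP j : unit_ray t (r j).
  split; [move=> i|exact: mr|].
    rewrite mr ffunE; case: eqP => _; rewrite ?mulr1 ?ler01 ?lexx //.
    by rewrite c0 ler_piMr // ltW.
  rewrite -(cards1 (h j)); apply: subset_leq_card; apply/fintype.subsetP => i.
  by rewrite !inE mr ffunE; case: eqP => // _; rewrite mulr1 ltxx andbF.
have rE j i : (r j i == 1 :> R) = (i != h j).
  by rewrite ffunE; case: (i =P h j) => _ /=; [rewrite lt_eqF|rewrite eqxx].
apply: (@skeleton_iso (complete_graph n) (Ordinal (ltnW n_gt1)) r) => //=.
- move=> j l _ _ jl; apply: (bij_inj h_bij); apply/eqP.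
  by have := rE j (h j); rewrite jl rE eqxx => /negbFE.
- move=> v /(ray_vectorP s_gt0 s_ltI)[P [p [cP pP vE]]].
  have fl : Num.floor s = n%:Z - 2.
    by apply: floor_def; rewrite !intrD -pmulrn; move: s_lt sn; rewrite -[(-2)%:~R]/(-2 : R); lra.
  have [g hK gK] := h_bij; exists (g p) => //; apply/ffunP => i; rewrite ffunE gK vE.
  have PE : P = ~: [set p]%SET.
    apply/eqP; rewrite eqEcard cardsC1 cardI; apply/andP; split.
      apply/fintype.subsetP => k kP; rewrite !inE; apply: contraNneq pP => <- //.
    by move: cP; rewrite fl; lia.
  rewrite PE !inE /frac_part fl; case: eqP => //= _.
  by rewrite /c intrD -pmulrn.
move=> j l _ _; suff h2 : j <> l -> #|slack t (r j + r l)| = 2%N by split=> [jl|[]]; auto.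
move=> jl; have hjl : h j != h l by rewrite (inj_eq (bij_inj h_bij)); apply/eqP.
have -> : slack t (r j + r l) = [set h j; h l]%SET.
  apply/setP => i; rewrite slack_sum // !inE !ffunE.
  have [->|ij] := eqVneq i (h j); first by rewrite (negPf hjl) /=; lra.
  by case: eqVneq => /= [_|_]; [lra|rewrite ltxx andbF].
by rewrite cards2 hjl.
Qed.

Lemma agree_off_pair v w (p q : I) : p != q -> mass v = mass w ->
  (forall k, k != p -> k != q -> v k = w k) -> (v p + v q = w p + w q :> R).
Proof.
move=> pq; rewrite /mass (bigD1 p) // (bigD1 q) 1?eq_sym //= [RHS](bigD1 p) // [X in _ = _ + X](bigD1 q) 1?eq_sym //=.
move=> e ag; move: e; rewrite (eq_bigr (fun i => w i : R)) => [|k /andP[]]; last exact: ag.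
by rewrite !addrA => /addIr.
Qed.

(** Let [p] and [q] be the positions of the value [c] in [v] and [w].  If
    [p = q], then equal sums and only one further slack coordinate would give
    [v = w].  If [p != q], both positions are slack at [v + w], so adjacency
    means that [v] and [w] agree elsewhere.  Equality of the sums then gives
    [v q = w p]; this common value is 1 in the first case of the statement and 0
    in the second. *)
Lemma adjacent_rays_frac F G v w : s \isn't a Num.int ->
  extreme_ray C F -> extreme_ray C G -> F <> G ->
  ray_vector s v -> ray_vector s w -> F v -> G w ->
  adjacent_rays C F G <-> same_support v w \/ differ_by_position_of (frac_part s) v w.
Proof.
move=> sZ eF eG FG rv rw Fv Gw.
have [uv uw] := ((ray_vectorP s_gt0 s_ltI v).1 rv, (ray_vectorP s_gt0 s_ltI w).1 rw).
have FE := extreme_rayE t_gt0 eF Fv uv; have GE := extreme_rayE t_gt0 eG Gw uw.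
have vw : v <> w by move=> vw; apply: FG; rewrite FE GE vw.
rewrite FE GE adjacent_raysP //.
have mvw : mass v = mass w by case: uv uw => [_ -> _] [_ -> _].
set c := frac_part s.
have c01 : 0 < c < 1.
  have := frac_part_bounds s; rewrite -/c => /andP[c0 ->]; rewrite andbT lt_def c0 andbT.
  by rewrite subr_eq0 eq_sym -intrEfloor.
have [c0 c1] := andP c01.
have [p vp v01] : exists2 p, v p = c & forall i, i != p -> v i = 0 \/ v i = 1.
  have [P [p [_ pP vE]]] := rv; exists p; first by rewrite vE (negPf pP) eqxx.
  by move=> i /negPf ip; rewrite vE ip; case: ifP; auto.
have [q wq w01] : exists2 q, w q = c & forall i, i != q -> w i = 0 \/ w i = 1.
  have [P [q [_ qP wE]]] := rw; exists q; first by rewrite wE (negPf qP) eqxx.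
  by move=> i /negPf iq; rewrite wE iq; case: ifP; auto.
have vc i : v i = c -> i = p.
  by move=> vi; apply/eqP/negPn/negP => /v01[]; rewrite vi; lra.
have wc i : w i = c -> i = q.
  by move=> wi; apply/eqP/negPn/negP => /w01[]; rewrite wi; lra.
have wb i := unit_ray_bounds t_gt0 i uw; have vb i := unit_ray_bounds t_gt0 i uv.
have mem_slack i : i \notin slack t (v + w) -> v i = w i /\ (v i = 0 \/ v i = 1).
  rewrite slack_sum // => /negP nh; have := vb i; have := wb i => hw hv.
  have [e|e] := lerP (v i + w i) 0; first by split; [|left]; lra.
  have : 1 + 1 <= v i + w i by rewrite leNgt; apply/negP => e'; apply: nh; rewrite e e'.
  by move=> ?; split; [|right]; lra.
have ps : p \in slack t (v + w).
  by rewrite slack_sum // vp; have := wb p; lra.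
have qs : q \in slack t (v + w).
  by rewrite slack_sum // wq; have := vb q; lra.
have [pq|pq] := eqVneq p q.
  split; last case.
  - move=> s2; exfalso; apply: vw.
    have /cards1P[a sa] : #|slack t (v + w) :\ p| == 1%N.
      by move: s2; rewrite (cardsD1 p) ps => /eqP; rewrite eqSS.
    have ap : p != a.
      by apply/eqP => pa; have := set11 a; rewrite -sa !inE pa eqxx.
    have ag k : k != p -> k != a -> v k = w k.
      move=> kp ka; apply: (mem_slack k _).1; apply/negP => ks.
      have : k \in slack t (v + w) :\ p by rewrite in_setD1 kp.
      by rewrite sa inE (negPf ka).
    have vpwp : v p = w p :> R by rewrite vp pq wq.
    have va : v a = w a :> R.
      by have := agree_off_pair ap mvw ag; rewrite vpwp; exact: addrI.
    apply/ffunP => k; have [->//|kp] := eqVneq k p; have [->//|ka] := eqVneq k a.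
    exact: ag.
  - move=> ss; exfalso; apply: vw; apply/ffunP => k.
    have [->|kp] := eqVneq k p; first by rewrite vp pq wq.
    have := ss k; have := v01 k kp; rewrite pq in kp; have := w01 k kp.
    by case=> ->; case=> -> //; rewrite eqxx oner_eq0.
  - move=> [i [j [vi wj vj _ _]]]; exfalso.
    by move: vj; rewrite (wc j wj) -pq vp; lra.
have key : #|slack t (v + w)| = 2%N <-> forall k, k != p -> k != q -> v k = w k.
  split=> [s2 k kp kq|ag].
    apply: (mem_slack k _).1; apply/negP => ks.
    have : [set p; q]%SET \proper slack t (v + w).
      apply/properP; split; last by exists k => //; rewrite !inE negb_or kp.
      by apply/fintype.subsetP => i; rewrite in_set2 => /orP[] /eqP ->.
    by move=> /proper_card; rewrite s2 cards2 pq.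
  have -> : slack t (v + w) = [set p; q]%SET; last by rewrite cards2 pq.
  apply/setP => i; rewrite in_set2; have [->|ip] := eqVneq i p; first by rewrite ps.
  have [->|iq] := eqVneq i q; first by rewrite qs.
  rewrite slack_sum // ag //; case: (w01 i iq) => ->; rewrite ?addr0 ltxx ?andbF //.
rewrite key; split=> [ag|[ss|[i [j [vi wj vj wi ag]]]] k kp kq].
- have e : v q = w p :> R by have := agree_off_pair pq mvw ag; rewrite vp wq; lra.
  rewrite eq_sym in pq; case: (v01 q pq) => vq.
    by right; exists p, q; split=> //; rewrite -e.
  left=> k; have [->|kp] := eqVneq k p; first by rewrite vp -e vq oner_eq0 gt_eqF.
  have [->|kq] := eqVneq k q; first by rewrite wq vq oner_eq0 gt_eqF.
  by rewrite ag.
- have := ss k; case: (v01 k kp) => ->; case: (w01 k kq) => -> //; rewrite eqxx oner_eq0 //.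
by apply: ag; [rewrite (vc i vi)|rewrite (wc j wj)].
Qed.

End SkeletonAndRidges.

(** * The ridge graph *)

Section Ridges.
Variables (R : realType) (I : finType) (t : R) (n : nat) (h : 'I_n -> I).
Hypotheses (t_gt1 : 1 < t) (t_lt : t < n%:R) (h_bij : bijective h).
Local Notation E := (vec R I).
Local Notation C := (hyper_cone t : set E).

Let cardI : #|I| = n.
Proof. by rewrite -[RHS]card_ord; apply/esym/bij_eq_card/h_bij. Qed.

Let t_ltI : t < #|I|%:R. Proof. by rewrite cardI. Qed.

(** For [n - 1 <= t] the cuts [x i = 0] are too small to be facets. *)
Lemma simplex_ridge : n%:R - 1 <= t -> (3 <= n)%N ->
  graph_iso (ridge_graph C) (complete_graph n).
Proof.
move=> tn n3; have I3 : (3 <= #|I|)%N by rewrite cardI.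
have fac i : facet C (facet_cut t (i, false)) by apply: facet_cut_facet.
apply: (@graph_iso_from (ridge_graph C) (complete_graph n)
  (Ordinal (ltnW (ltnW n3))) (fun j => facet_cut t (h j, false))) => //=.
- by move=> j l _ _ /(facet_cut_inj t_gt1 t_ltI I3 (fac _)) [] /(bij_inj h_bij).
- move=> F fF; have [[i b] FE _] := facetP t_gt1 t_ltI I3 fF.
  case: b FE => FE.
    by have := facet_zero t_gt1 t_ltI I3 fF FE; rewrite cardI; lra.
  by have [g _ gK] := h_bij; exists (g i); rewrite // gK.
move=> j l _ _; split=> [jl|adj jl].
  by apply: adjacent_tight_facets; rewrite ?cardI // => /(bij_inj h_bij).
by apply: (not_adjacent_parallel t_gt1 t_ltI I3 (fac (h j))); rewrite {2}jl; exact: adj.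
Qed.

(** The label [true] of a vertex [(i, b)] stands for the facet [x i = 0] if [e]
    is [false], and for the opposite facet if [e] is [true].  Both choices are
    needed, because either kind of facet can be the one that loses its ridges. *)
Lemma cocktail_ridge (e : bool) (adjK : 'I_n * bool -> 'I_n * bool -> Prop) :
  (4 <= n)%N -> t < n%:R - 1 ->
  (forall x y, adjK x y <-> x.1 <> y.1 /\
     ((~~ (e (+) x.2) + ~~ (e (+) y.2))%:R < t /\
      t < n%:R - ((e (+) x.2) + (e (+) y.2))%:R)) ->
  graph_iso (ridge_graph C) (Graph [set: 'I_n * bool] adjK).
Proof.
move=> n4 tn adjKE; have I4 : (4 <= #|I|)%N by rewrite cardI.
have I3 := ltnW I4.
have fac ib : facet C (facet_cut t ib) by apply: facet_cut_facet => //; rewrite cardI.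
apply: (@graph_iso_from (ridge_graph C) (Graph [set: 'I_n * bool] adjK)
  (Ordinal (ltnW (ltnW (ltnW n4))), true)
  (fun x => facet_cut t (h x.1, e (+) x.2))) => //=.
- move=> [j b] [l c] _ _ /(facet_cut_inj t_gt1 t_ltI I3 (fac _)) [] /(bij_inj h_bij) ->.
  by move/addbI ->.
- move=> F fF; have [[i b] FE _] := facetP t_gt1 t_ltI I3 fF.
  have [g _ gK] := h_bij; exists (g i, e (+) b) => //=.
  by rewrite gK addKb FE.
move=> [j b] [l c] _ _; rewrite adjKE /=.
have [<-|jl] := eqVneq j l.
  by split=> [[//]|/(not_adjacent_parallel t_gt1 t_ltI I3 (fac _))].
have hjl : h j <> h l by move/(bij_inj h_bij); apply/eqP.
rewrite adjacent_facet_cuts // cardI; split=> [[//]|H]; split=> //.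
exact/eqP.
Qed.

End Ridges.

Lemma adj_cube (x y : {ffun 'I_3 -> bool}) :
  #|[set i : 'I_3 | x i != y i]%SET| =
  ((x (inord 0) != y (inord 0)) + (x (inord 1) != y (inord 1)) + (x (inord 2) != y (inord 2)))%N.
Proof.
rewrite -sum1_card big_mkcond /= !big_ord_recl big_ord0 addn0 !inE addnA.
have -> : ord0 = inord 0 :> 'I_3 by apply/val_inj; rewrite /= inordK.
have -> : lift (inord 0) ord0 = inord 1 :> 'I_3 by apply/val_inj; rewrite /= /bump !inordK.
have -> : lift (inord 0) (lift ord0 ord0) = inord 2 :> 'I_3
  by apply/val_inj; rewrite /= /bump !inordK.
by case: eqP; case: eqP; case: eqP.
Qed.

(** The two vertices of a part become antipodal vertices of the cube: [(0, b)]
    goes to the constant word [b], and [(i, b)] with [i > 0] to the constant word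
    [~~ b] with the letter [i - 1] flipped.  Then [b] is the parity of the word,
    and words of distinct parity are adjacent unless they are antipodal. *)
Lemma cube_cocktail : graph_iso (cocktail_minus_2K (2 + 2)) (cube_graph 3).
Proof.
pose f (x : 'I_(2 + 2) * bool) : {ffun 'I_3 -> bool} :=
  [ffun j : 'I_3 => (x.1 != ord0) (+) x.2 (+) (j.+1 == x.1 :> nat)].
have f_inj : injective f.
  move=> [i b] [j c] /ffunP fxy; have := fxy (inord 0); have := fxy (inord 1); have := fxy (inord 2).
  rewrite !ffunE !inordK //=.
  case: i j {fxy} => [[|[|[|[|i]]]] hi] [[|[|[|[|j]]]] hj] //=; case: b; case: c => //= _ _ _;
  by congr (_, _); apply: val_inj.
exists f; split; first split => //.
- by move=> x y _ _; exact: f_inj.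
- move=> y _; have /codomP[x ->] : y \in codom f.
    apply: inj_card_onto => //.
    by rewrite card_ffun card_prod !card_ord card_bool.
  by exists x.
move=> [i b] [j c] _ _.
have -> : adj (cocktail_minus_2K (2 + 2)) (i, b) (j, c) <-> (i != j :> nat) && (b (+) c).
  split=> [[[/eqP /= ij]]|/andP[/eqP ij bc]].
    by rewrite -val_eqE in ij; rewrite ij; case: b; case: c => //= nt nf; exfalso;
      [apply: nt|apply: nf].
  split; first split; first by move/(congr1 val).
    by clear ij; case: b c bc => [] [] //= _ [].
  by clear ij; case: b c bc => [] [] //= _ [].
rewrite /= adj_cube !ffunE !inordK //=.
case: i j => [[|[|[|[|i]]]] hi] [[|[|[|[|j]]]] hj] //=; case: b; case: c => //=; by split.
Qed.

(** * The cone of super-metrics on m + 2 points *)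

Section SuperMetric.
Variables (R : realType) (m : nat) (s : R).
Local Notation I := (msimplex m m.+2).

Lemma opposite_face_proof (i : 'I_m.+2) : #|[set: 'I_m.+2]%SET :\ i| == m.+1.
Proof. by have := cardsD1 i [set: 'I_m.+2]%SET; rewrite cardsT card_ord inE => /eqP; rewrite eqSS eq_sym. Qed.

Definition opposite_face (i : 'I_m.+2) : I :=
  exist _ ([set: 'I_m.+2]%SET :\ i) (opposite_face_proof i).

Lemma opposite_face_bij : bijective opposite_face.
Proof.
have inj : injective opposite_face.
  move=> i j /(congr1 val) /= /setP /(_ i); rewrite !inE eqxx /= andbT.
  by move/esym => /negbFE/eqP.
apply: inj_card_bij inj _; rewrite card_ord.
have -> : #|I| = #|[set A : {set 'I_m.+2} | #|A| == m.+1]%SET|.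
  by rewrite card_sig; apply: eq_card => A; rewrite !inE.
by rewrite card_draws card_ord binSn.
Qed.

Lemma value_at_opposite (d : vec R I) i :
  value_at d ([set: 'I_m.+2]%SET :\ i) = d (opposite_face i).
Proof. by rewrite /value_at insubT ?opposite_face_proof // => p; congr (d _); apply: val_inj. Qed.

(** The only set of [m + 2] points is the whole of V_(m+2), so there is one
    simplex inequality for each [i]; adding the value at [i] to both sides gives
    the inequality of the cone. *)
Lemma SMET_hyper_cone : @SMET R m s m.+2 = hyper_cone (s + 1).
Proof.
have [g hK gK] := opposite_face_bij.
have massE (d : vec R I) i : mass d =
    \sum_(k in [set: 'I_m.+2]%SET :\ i) value_at d ([set: 'I_m.+2]%SET :\ k) + d (opposite_face i).
  rewrite /mass (reindex opposite_face) /=; last exact/onW_bij/opposite_face_bij.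
  rewrite (bigD1 i) //= addrC; congr (_ + _); apply: eq_big => [k|k _].
    by rewrite !inE andbT.
  by rewrite value_at_opposite.
apply/seteqP; split=> d.
  move=> [H d0] a; split=> //; rewrite -(gK a) (massE d (g a)) mulrDl mul1r lerD2r.
  by rewrite -value_at_opposite; apply: H; rewrite ?inE // cardsT card_ord.
move=> H; split=> [T i cT _|a]; last by case: (H a).
have -> : T = [set: 'I_m.+2]%SET.
  by apply/eqP; rewrite eqEcard finset.subsetT cardsT card_ord cT leqnn.
have [_] := H (opposite_face i); rewrite (massE d i) mulrDl mul1r lerD2r.
by rewrite value_at_opposite.
Qed.

End SuperMetric.

Theorem theorem3 (R : realType) (m : nat) (s : R)
    (hm : (1 <= m)%N) (hs0 : 0 < s) (hsm : s < m%:R + 1) :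
  let C := @SMET R m s m.+2 in
  (* (i) *)
  ((exists! O, exists F, extreme_ray C F /\ O = face_orbit C F) /\
   (forall F, extreme_ray C F -> exists v, F v /\ ray_vector s v) /\
   (forall v, ray_vector s v -> exists F, extreme_ray C F /\ F v) /\
   (forall v w F G, ray_vector s v -> ray_vector s w -> v <> w ->
      extreme_ray C F -> extreme_ray C G -> F v -> G w -> F <> G)) /\
  (* (ii.1) *)
  (forall k : nat, s = k%:R ->
     graph_iso (skeleton_graph C) (johnson_graph m.+2 k.+1)) /\
  (* (ii.2) *)
  (s \isn't a Num.int ->
   forall F G, extreme_ray C F -> extreme_ray C G -> F <> G ->
   forall v w, ray_vector s v -> ray_vector s w -> F v -> G w ->
     (adjacent_rays C F G <->
      same_support v w \/ differ_by_position_of (frac_part s) v w)) /\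
  (* (iii.1) *)
  (m%:R <= s -> s < m%:R + 1 ->
     graph_iso (skeleton_graph C) (complete_graph m.+2) /\
     graph_iso (ridge_graph C) (complete_graph m.+2)) /\
  (* (iii.2) *)
  (1 < s -> s < m%:R - 1 ->
     graph_iso (ridge_graph C) (cocktail_graph m.+2)) /\
  (* (iii.3) *)
  ((s = 1 /\ 1 < m%:R - 1 :> R) \/ (1 < s /\ s = m%:R - 1) ->
     graph_iso (ridge_graph C) (cocktail_minus_K m.+2)) /\
  (* (iii.4) *)
  (s = 1 /\ 1 = m%:R - 1 :> R ->
     graph_iso (ridge_graph C) (cocktail_minus_2K (2 + 2)) /\
     graph_iso (ridge_graph C) (cube_graph 3)).
Proof.
move=> C; have bij := @opposite_face_bij m.
have CE : C = hyper_cone (s + 1) := SMET_hyper_cone m s.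
have nE : m.+2%:R = m%:R + 2 :> R by rewrite -addn2 natrD.
have tn : s + 1 < m.+2%:R by rewrite nE; lra.
have t0 : 0 < s + 1 by lra.
have t1 : 1 < s + 1 by lra.
have tI : s + 1 < #|msimplex m m.+2|%:R by rewrite -(bij_eq_card bij) card_ord.
rewrite {}CE {C}.
have m_ge3 : 2 < m%:R :> R -> (4 <= m.+2)%N by rewrite ltr_nat; lia.
split; [split; [|split; [|split]]|split; [|split; [|split; [|split; [|split]]]]].
- exact: unique_orbit bij.
- move=> F eF; have [v Fv uv] := extreme_ray_unit t0 eF.
  by exists v; split=> //; apply/ray_vectorP.
- move=> v /(ray_vectorP hs0 tI) uv; exists (min_face (s + 1) v).
  by split; [exact: extreme_ray_min_face|apply: min_face_refl; case: uv].
- move=> v w F G /(ray_vectorP hs0 tI) uv /(ray_vectorP hs0 tI) uw vw eF eG Fv Gw FG.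
  by apply: vw; apply: (extreme_ray_unique t0 eF) => //; rewrite FG.
- by move=> k sk; exact: (johnson_skeleton hs0 tn bij sk).
- by move=> sZ F G eF eG FG v w rv rw Fv Gw; exact: (adjacent_rays_frac hs0 tn bij).
- move=> ms _; split; first by apply: (simplex_skeleton hs0 tn bij) => //; rewrite nE; lra.
  by apply: (simplex_ridge t1 tn bij) => //; rewrite nE; lra.
- move=> s1 sm; apply: (@cocktail_ridge _ _ _ _ _ t1 tn bij true) => [||x y].
  + by apply: m_ge3; lra.
  + by rewrite nE; lra.
  rewrite nE; split=> [xy|[]//]; split=> //=.
  by case: x.2; case: y.2; split; rewrite /=; lra.
- move=> [[s1 sm]|[s1 sm]].
  + apply: (@cocktail_ridge _ _ _ _ _ t1 tn bij true) => [||x y].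
    * by apply: m_ge3; lra.
    * by rewrite nE; lra.
    rewrite nE s1 /=; split.
    * move=> [xy nW]; split=> //; move: nW.
      by case: x.2; case: y.2 => nW; split; rewrite /=; lra.
    move=> [xy [lt _]]; split=> // -[xt yt]; move: lt; rewrite xt yt /=; lra.
  apply: (@cocktail_ridge _ _ _ _ _ t1 tn bij false) => [||x y].
  + by apply: m_ge3; lra.
  + by rewrite nE; lra.
  rewrite nE sm /=; split.
    move=> [xy nW]; split=> //; move: nW.
    by case: x.2; case: y.2 => nW; split; rewrite /=; lra.
  move=> [xy [_ lt]]; split=> // -[xt yt]; move: lt; rewrite xt yt /=; lra.
move=> [s1 m1]; have /eqP : m%:R = 2%:R :> R by lra.
rewrite eqr_nat => /eqP m2; subst m.
suff iso : graph_iso (ridge_graph (@hyper_cone R (msimplex 2 4) (s + 1))) (cocktail_minus_2K (2 + 2)).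
  by split=> //; exact: graph_iso_trans iso cube_cocktail.
apply: (@cocktail_ridge _ _ _ _ _ t1 tn bij false) => [//||x y].
  by rewrite nE; lra.
rewrite nE s1 /=; split.
  move=> [[xy nt] nf]; split=> //; move: nt nf.
  by case: x.2; case: y.2 => nt nf; split; rewrite /=; lra.
move=> [xy [lt gt]]; split; first split=> //.
  by move=> -[xt yt]; move: gt; rewrite xt yt /=; lra.
by move=> -[xt yt]; move: lt; rewrite xt yt /=; lra.
Qed.
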